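(* Consider a geometrically consistent dimer model on a torus. For each two dimensional cone $\sigma$ in the global zig-zag fan $\Xi$, the perfect matching $P(\sigma)$ is extremal. Furthermore, the corresponding vertex of the degree one polygon in $N_o^+$ has multiplicity one.
   Context: **Dimer model and quiver.** A dimer model on a torus $T$ is a finite bipartite tiling of $T$: a finite polygonal cell decomposition whose vertices (all of valence at least 2) are coloured black and white so that every edge joins a black vertex to a white vertex. The associated quiver $Q$ is the dual cell decomposition: its set of vertices $Q_0$ is dual to the tiles, its set of arrows $Q_1$ is dual to the edges, and its set of faces $Q_2$ is dual to the dimer vertices; each arrow is oriented so that the black dimer vertex is on its left and the white one on its right. Faces dual to black (white) vertices are called black (white) faces; their boundaries are oriented cycles. An arrow $a$ has tail $ta$ and head $ha$. $\widetilde{Q}$ denotes the lift of $Q$ to the universal cover of $T$. Write $H_1(Q)=H_1(T;\mathbb{Z})$. **Perfect matchings.** $\mathbb{Z}^{Q_i}$ denotes integer functions on $Q_i$. Let $d:\mathbb{Z}^{Q_0}\to\mathbb{Z}^{Q_1}$, $(dg)(a)=g(ha)-g(ta)$, and $d:\mathbb{Z}^{Q_1}\to\mathbb{Z}^{Q_2}$, $(dv)(f)=\sum_{a\in\partial f}v(a)$. Let $\underline{1}\in\mathbb{Z}^{Q_2}$ be the constant function 1, $N=\{v\in\mathbb{Z}^{Q_1}: dv\in\mathbb{Z}\underline{1}\}$, $N^+=N\cap\mathbb{N}^{Q_1}$. The degree of $v\in N$ is the $\lambda$ with $dv=\lambda\underline{1}$. A perfect matching is an element $\pi\in\mathbb{N}^{Q_1}$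 with $d\pi=\underline{1}$. Let $N_o=N/d(\mathbb{Z}^{Q_0})$ (rank 3) and let $N_o^+$ be the intersection of $N_o$ with the real cone generated by the image of $N^+$. The images of perfect matchings have degree 1, and the degree one polygon is their convex hull (so $N_o^+$ is the cone on it). The multiplicity of a lattice point of this polygon is the number of perfect matchings whose image in $N_o$ is that point. A perfect matching is extremal if its image is a vertex of the polygon. **Geometric consistency.** The quad graph is the tiling of $T$ whose vertices are the dimer vertices together with the quiver vertices, with edges connecting a dimer vertex $f$ to a quiver vertex $v$ when the quiver face dual to $f$ has $v$ in its boundary; its faces are quadrilaterals. The dimer model is geometrically consistent if, for some flat metric on the torus, its quad graph has a rhombic embedding, i.e. an embedding in the torus such that all edges are line segments of the same length. **Zig-zag flows.** A zig-zag flow is a map $\widetilde{\eta}:\mathbb{Z}\to\widetilde{Q}_1$ such that for every $n$: $h\widetilde{\eta}_n=t\widetilde{\eta}_{n+1}$; $\widetilde{\eta}_{2n},\widetilde{\eta}_{2n+1}$ are in the boundary of the same black face; $\widetilde{\eta}_{2n-1},\widetilde{\eta}_{2n}$ are in the boundary of the same white face. Flows are taken up to shifting the index by an even integer. Projecting to $Q$ gives a periodic zig-zag path $\eta$; $[\eta]\in H_1(Q)$ is the class of the sum of its arrows over a single period; it is non-zero and primitive under geometric consistency. $\widetilde\eta$ is a representative of a ray $\gamma$ if $[\eta]$ is the primitive generator of $\gamma$. **Zig-zag fans.** For a face $f$, the local zig-zag fan $\xi(f)$ is the complete fan in $H_1(Q)\otimes\mathbb{R}$ whose rays are generated by the classes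 of those zig-zag flows which contain an arrow of the boundary of (a lift to $\widetilde{Q}$ of) $f$. The global zig-zag fan $\Xi$ is the fan whose rays are generated by the classes of all zig-zag flows; it refines every $\xi(f)$. **The matchings $P(\sigma)$.** Under geometric consistency each ray of $\xi(f)$ has a unique representative flow meeting the boundary of (a fixed lift of) $f$, and the two rays of a two dimensional cone $\tau$ of $\xi(f)$ have representatives meeting in a unique arrow of the boundary of $f$, called the arrow corresponding to $\tau$. For a two dimensional cone $\sigma$ of $\Xi$ and $f\in Q_2$, let $\sigma_f$ be the unique two dimensional cone of $\xi(f)$ containing $\sigma$ and let $P_f(\sigma)\in\mathbb{Z}^{Q_1}$ be 1 on the arrow of $\partial f$ corresponding to $\sigma_f$ and 0 on all other arrows. Put $P(\sigma)=\tfrac12\sum_{f\in Q_2}P_f(\sigma)$; this is a perfect matching. *)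

(* Defs.v *)
From HB Require Import structures.
From mathcomp Require Import all_boot all_order all_algebra all_fingroup.
From mathcomp Require Import boolp classical_sets cardinality reals.

Set Implicit Arguments.
Unset Strict Implicit.
Unset Printing Implicit Defensive.

Import Order.TTheory GRing.Theory Num.Theory.

Local Open Scope ring_scope.

(* A cellular bipartite graph on an oriented closed surface is encoded as a   *)
(* combinatorial map.  An edge of the dimer model is identified with the dual *)
(* arrow of the quiver Q.  [bnext a] is the arrow that follows [a] along the  *)
(* boundary of the black face of Q containing [a] (on the dimer side: the     *)
(* next edge counterclockwise around the black end of [a]); [wnext a] follows *)
(* [a] along the boundary of the white face (next edge clockwise around the   *)
(* white end).  Thus black faces lie on the left of their boundary arrows and *)
(* white faces on the right.                                                  *)
Record bipartite_map := BipartiteMap {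
  arrow : finType;
  bnext : {perm arrow};
  wnext : {perm arrow} }.

Section Quiver.
Variable D : bipartite_map.

(* Colours: true is black, false is white. *)
Definition next (c : bool) : {perm arrow D} := if c then bnext D else wnext D.

(* The rotation of the arrows leaving a quiver vertex: from [a], step back    *)
(* along its black face to an incoming arrow, then forward along the white    *)
(* face of the latter.  A vertex of Q (a tile of the dimer model) is encoded  *)
(* by the set of arrows leaving it.                                           *)
Definition rot : {perm arrow D} := ((bnext D)^-1 * wnext D)%g.

Definition Q0 : finType := {v : {set arrow D} | v \in porbits rot}.

Lemma tl_subproof (a : arrow D) : porbit rot a \in porbits rot.
Proof. exact: imset_f. Qed.

Definition tl (a : arrow D) : Q0 :=
  Sub (porbit rot a) (tl_subproof a).

Definition hd (a : arrow D) : Q0 := tl (bnext D a).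

Lemma hd_next (c : bool) (a : arrow D) : hd a = tl (next c a).
Proof.
case: c; first by [].
apply: val_inj; apply/eqP; rewrite eq_sym eq_porbit_mem; apply/porbitP.
by exists 1%N; rewrite /hd /= expg1 /rot permM permK.
Qed.

(* A face is its colour together with the set of arrows of its boundary. *)
Definition Q2 : finType :=
  {f : bool * {set arrow D} | f.2 \in porbits (next f.1)}.

Definition boundary (f : Q2) : {set arrow D} := (val f).2.

Definition d0 (V : zmodType) (g : Q0 -> V) : {ffun arrow D -> V} :=
  [ffun a => g (hd a) - g (tl a)].

Definition d1 (V : zmodType) (v : {ffun arrow D -> V}) : {ffun Q2 -> V} :=
  [ffun f => \sum_(a in boundary f) v a].

Definition is_cycle (z : arrow D -> int) : Prop :=
  forall v : Q0, \sum_(a | hd a == v) z a = \sum_(a | tl a == v) z a.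

End Quiver.

(* The vertices of the dimer model are the faces of Q, so valence at least 2  *)
(* means that [bnext] and [wnext] have no fixed point; by connectedness and   *)
(* Euler's formula the surface is a torus.                                    *)
Record dimer_model := DimerModel {
  dimer_map :> bipartite_map;
  dimer_valence : forall (c : bool) (a : arrow dimer_map), next dimer_map c a != a;
  dimer_connected :
    [transitive <<[set bnext dimer_map; wnext dimer_map]>>%g,
      on [set: arrow dimer_map] | 'P];
  dimer_torus :
    (#|Q0 dimer_map| + #|Q2 dimer_map| = #|arrow dimer_map|)%N }.

(* An identification of H_1(Q) = (1-cycles modulo face boundaries) with Z^2,  *)
(* given by a Z^2-valued cocycle on the arrows.  It plays the role of the     *)
(* isomorphism H_1(T; Z) = Z^2 and describes the universal cover of T as a    *)
(* Z^2-cover.                                                                 *)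
Record homology_marking (D : dimer_model) := HomologyMarking {
  shift : arrow D -> 'rV[int]_2;
  shift_face : forall f : Q2 D, \sum_(a in boundary f) shift a = 0;
  shift_onto : forall m : 'rV[int]_2, exists2 z : arrow D -> int,
    is_cycle z & \sum_a shift a *~ z a = m;
  shift_inj : forall z : arrow D -> int, is_cycle z ->
    \sum_a shift a *~ z a = 0 ->
    exists c : Q2 D -> int, forall a, z a = \sum_(f | a \in boundary f) c f }.

Section UniversalCover.
Variables (D : dimer_model) (H : homology_marking D).

(* The universal cover of Q; Z^2 acts by translation of the second component. *)
Definition larrow : Type := (arrow D * 'rV[int]_2)%type.
Definition lvertex : Type := (Q0 D * 'rV[int]_2)%type.

Definition ltail (x : larrow) : lvertex := (tl x.1, x.2).
Definition lhead (x : larrow) : lvertex := (hd x.1, x.2 + shift H x.1).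

Definition lnext (c : bool) (x : larrow) : larrow :=
  (next D c x.1, x.2 + shift H x.1).

(* The face of colour [c] of the universal cover with [x] in its boundary,    *)
(* encoded by its set of boundary arrows.                                     *)
Definition lface (c : bool) (x : larrow) : set larrow :=
  [set y | exists k : nat, y = iter k (lnext c) x]%classic.

End UniversalCover.

Section Plane.
Variable R : realType.
Implicit Types u v : 'rV[R]_2.

Definition toR (m : 'rV[int]_2) : 'rV[R]_2 := map_mx intr m.

Definition det2 u v : R := u 0 0 * v 0 1 - u 0 1 * v 0 0.

(* The library norm on row vectors is the sup norm. *)
Definition enorm u : R := Num.sqrt (u 0 0 ^+ 2 + u 0 1 ^+ 2).

Definition ray u : set 'rV[R]_2 :=
  [set w | exists2 s : R, 0 <= s & w = s *: u]%classic.

Definition cone2 u v : set 'rV[R]_2 :=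
  [set w | exists s t : R, [/\ 0 <= s, 0 <= t & w = s *: u + t *: v]]%classic.

Definition open_cone2 u v : set 'rV[R]_2 :=
  [set w | exists s t : R, [/\ 0 < s, 0 < t & w = s *: u + t *: v]]%classic.

Definition two_dimensional (tau : set 'rV[R]_2) : Prop :=
  exists u v, [/\ tau u, tau v & det2 u v != 0].

(* The fan in the plane whose rays are generated by the elements of S: its    *)
(* two dimensional cones are the sectors between cyclically consecutive rays. *)
Definition fan (S : set 'rV[int]_2) : set (set 'rV[R]_2) :=
  [set tau | [\/ tau = [set 0],
                 exists2 m, S m & tau = ray (toR m)
               | exists m1 m2, [/\ S m1, S m2, 0 < det2 (toR m1) (toR m2),
                   tau = cone2 (toR m1) (toR m2)
                 & forall m, S m -> ~ open_cone2 (toR m1) (toR m2) (toR m)]]]%classic.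

Definition rays_of_cone (tau g1 g2 : set 'rV[R]_2) : Prop :=
  exists u v, [/\ 0 < det2 u v, tau = cone2 u v, g1 = ray u & g2 = ray v].

Definition primitive (m : 'rV[int]_2) : Prop := coprimez (m 0 0) (m 0 1).

End Plane.

Section Consistency.
Variables (R : realType) (D : dimer_model) (H : homology_marking D).

(* Positions of the lifted vertices of the quad graph: quiver vertices and    *)
(* dimer vertices (dual to lifted faces, with their colour).                  *)
Variables (posV : lvertex D -> 'rV[R]_2) (posF : bool -> set (larrow D) -> 'rV[R]_2).

(* The edges of the lifted quad graph are indexed by pairs (c, x): one edge   *)
(* for each corner of a face, namely the corner at the tail of [x] of the     *)
(* face [lface H c x].                                                        *)
Definition quad_point (c : bool) (x : larrow D) (t : R) : 'rV[R]_2 :=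
  (1 - t) *: posF c (lface H c x) + t *: posV (ltail x).

(* The straight-line realization is injective on the lifted quad graph (two   *)
(* points with the same image are the same dimer vertex, the same quiver      *)
(* vertex, or the same point of the same edge).                               *)
Definition quad_injective : Prop :=
  forall c x s c' x' s', 0 <= s <= 1 -> 0 <= s' <= 1 ->
    quad_point c x s = quad_point c' x' s' ->
    s = s' /\ [\/ [/\ s = 0, c = c' & lface H c x = lface H c' x'],
                  s = 1 /\ ltail x = ltail x'
                | c = c' /\ x = x'].

(* The rows of L span the lattice of the flat torus R^2 / Z^2 L. *)
Definition equivariant (L : 'M[R]_2) : Prop :=
  (forall v m n, posV (v, m + n) = posV (v, m) + toR R n *m L) /\
  (forall c a m n, posF c (lface H c (a, m + n)) =
                   posF c (lface H c (a, m)) + toR R n *m L).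

(* The quadrilateral of [x] has counterclockwise vertices: tail, white dimer  *)
(* vertex, head, black dimer vertex.  This says that the embedding is one of  *)
(* the oriented tiling and not just of its 1-skeleton.                        *)
Definition quad_oriented : Prop :=
  forall x : larrow D,
    0 < det2 (posF false (lface H false x) - posV (ltail x))
             (posF true (lface H true x) - posV (ltail x)).

Definition rhombic_embedding (L : 'M[R]_2) : Prop :=
  [/\ L \in unitmx, equivariant L, quad_injective, quad_oriented
    & exists r : R, forall c x, enorm (posF c (lface H c x) - posV (ltail x)) = r].

End Consistency.

(* Every flat torus is R^2 modulo a lattice, and up to reflecting the metric  *)
(* an embedding can be taken orientation preserving.                          *)
Definition geometrically_consistent (R : realType) (D : dimer_model)
    (H : homology_marking D) : Prop :=
  exists L posV posF, @rhombic_embedding R D H posV posF L.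

Section ZigZag.
Variables (D : dimer_model) (H : homology_marking D).

Definition zigzag_flow (eta : int -> larrow D) : Prop :=
  forall n : int,
    [/\ lhead H (eta n) = ltail (eta (n + 1)),
        lface H true (eta (2 * n)) = lface H true (eta (2 * n + 1))
      & lface H false (eta (2 * n - 1)) = lface H false (eta (2 * n))].

Definition is_period (eta : int -> larrow D) (p : nat) : Prop :=
  (0 < p)%N /\ forall n : int, (eta (n + p%:Z)).1 = (eta n).1.

(* [m] is the class in H_1(Q) of the projection of [eta] to Q. *)
Definition flow_class (eta : int -> larrow D) (m : 'rV[int]_2) : Prop :=
  exists p : nat,
    [/\ is_period eta p, forall q, is_period eta q -> (p <= q)%N
      & m = \sum_(i < p) shift H (eta i%:Z).1].

Definition global_classes : set 'rV[int]_2 :=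
  [set m | exists2 eta, zigzag_flow eta & flow_class eta m]%classic.

Definition local_classes (f : Q2 D) : set 'rV[int]_2 :=
  [set m | exists eta, [/\ zigzag_flow eta, flow_class eta m
    & exists n : int, (eta n).1 \in boundary f]]%classic.

Variable R : realType.

Definition global_fan : set (set 'rV[R]_2) := fan global_classes.
Definition local_fan (f : Q2 D) : set (set 'rV[R]_2) := fan (local_classes f).

Definition represents (eta : int -> larrow D) (gamma : set 'rV[R]_2) : Prop :=
  exists m, [/\ flow_class eta m, primitive m & gamma = ray (toR R m)].

Definition corresponding_arrow (f : Q2 D) (tau : set 'rV[R]_2) (a : arrow D)
    : Prop :=
  a \in boundary f /\
  exists g1 g2 eta1 eta2, [/\ rays_of_cone tau g1 g2,
    zigzag_flow eta1 /\ represents eta1 g1,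
    zigzag_flow eta2 /\ represents eta2 g2
  & exists n1 n2 : int, eta1 n1 = eta2 n2 /\ (eta1 n1).1 = a].

(* The cone [tau] below is the unique two dimensional cone of the local fan   *)
(* at [f] containing [sigma].                                                 *)
Definition P_face (sigma : set 'rV[R]_2) (f : Q2 D) : {ffun arrow D -> int} :=
  [ffun a => (`[< exists tau, [/\ local_fan f tau, two_dimensional tau,
     (sigma `<=` tau)%classic & corresponding_arrow f tau a] >] : nat)%:Z].

Definition P_cone (sigma : set 'rV[R]_2) (a : arrow D) : rat :=
  2^-1 * \sum_(f : Q2 D) (P_face sigma f a)%:~R.

End ZigZag.

Section Matchings.
Variable D : dimer_model.
Implicit Types pi : {ffun arrow D -> int}.

Definition perfect_matching pi : Prop :=
  (forall a, 0 <= pi a) /\ d1 pi = [ffun => 1].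

(* The image of a cochain in N_o = N / d(Z^{Q_0}), as a coset. *)
Definition No_class pi : set {ffun arrow D -> int} :=
  [set u | exists g : Q0 D -> int, u = pi + d0 g]%classic.

Definition has_multiplicity (X : set {ffun arrow D -> int}) (n : nat) : Prop :=
  ([set pi | perfect_matching pi /\ No_class pi = X] #= `I_n)%classic%card.

Variable R : realType.

Definition cochainR pi : {ffun arrow D -> R} := [ffun a => (pi a)%:~R].

(* The coset of a real cochain modulo d(R^{Q_0}); N_o (x) R is the space of   *)
(* the cosets of elements of N (x) R.                                         *)
Definition NoR_class (u : {ffun arrow D -> R}) : set {ffun arrow D -> R} :=
  [set w | exists g : Q0 D -> R, w = u + d0 g]%classic.

Definition degree_one_polygon : set (set {ffun arrow D -> R}) :=
  [set X | exists (n : nat) (s : 'I_n -> R) (p : 'I_n -> {ffun arrow D -> int}),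
    [/\ forall i, 0 <= s i, \sum_i s i = 1, forall i, perfect_matching (p i)
      & X = NoR_class [ffun a => \sum_i s i * cochainR (p i) a]]]%classic.

(* Vertices of the polygon are its extreme points; the affine structure of    *)
(* the space of cosets is computed on representatives.                        *)
Definition polygon_vertex (X : set {ffun arrow D -> R}) : Prop :=
  degree_one_polygon X /\
  forall (u v : {ffun arrow D -> R}) (t : R), 0 < t < 1 ->
    degree_one_polygon (NoR_class u) -> degree_one_polygon (NoR_class v) ->
    X = NoR_class [ffun a => t * u a + (1 - t) * v a] ->
    NoR_class u = X /\ NoR_class v = X.

Definition extremal pi : Prop := polygon_vertex (NoR_class (cochainR pi)).

End Matchings.

(* Main.v *)
From mathcomp Require Import all_boot all_order all_algebra all_fingroup.
From mathcomp Require Import zify ring lra.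
From mathcomp Require Import boolp classical_sets cardinality reals.
From mathcomp Require Import topology normedtype.
Require Import Defs.

Set Implicit Arguments.
Unset Strict Implicit.
Unset Printing Implicit Defensive.

Import Order.TTheory GRing.Theory Num.Theory.
Import numFieldNormedType.Exports.

Local Open Scope ring_scope.

(* A zig-zag flow eta defines an integral 1-cocycle c on Q, equal to 1 on its  *)
(* even arrows and to -1 on its odd ones.  In a rhombic embedding two flows   *)
(* can cross in one direction only, prescribed by the transverse edge vectors *)
(* of their rhombi.  Hence pairing c with cycles is, up to a nonzero constant *)
(* common to all flows, the determinant with [eta], and the class y of the    *)
(* flow in which a given arrow is odd and the class z of the flow in which it *)
(* is even satisfy y /\ z > 0.  The four sectors (y,z), (z,-y), (-y,-z),      *)
(* (-z,y) attached to the corners of each quadrilateral cover every generic   *)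
(* direction once, while the corners around each vertex or face cover it at   *)
(* least once; as #Q_0 + #Q_2 = #Q_1 they cover it exactly once.  So the      *)
(* arrows a with v in the sector (y(a), z(a)) form a perfect matching pi_v,   *)
(* and pi_v = P(sigma) for v generic in sigma.                                *)
(*                                                                            *)
(* Let A be a nonempty set of quiver vertices closed under following arrows   *)
(* outside pi_v.  For a flow on a ray of sigma, pi_v matches all its black    *)
(* faces inside the flow, so the rest of the boundaries of these faces is a   *)
(* closed path avoiding pi_v; as the flows of the two rays of sigma cross,    *)
(* these paths lie all inside A or all outside.  Any cycle avoiding pi_v is   *)
(* homologically nontrivial, because every arrow lies on some pi_v', hence it *)
(* crosses such a flow; there is one in A, and one outside A unless A is      *)
(* everything.  So the complement of pi_v is strongly connected and supports  *)
(* a positive cycle w.  Pairing with w vanishes on pi_v and is positive on    *)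
(* every other perfect matching, which gives extremality and multiplicity 1.  *)
(*                                                                            *)
(* Primitivity of [eta]: one side of its strip of rhombi is the graph of a    *)
(* function; if [eta] = k m0, the intermediate value theorem makes it meet    *)
(* its translate by m0, and injectivity of the embedding forces k = 1.        *)

(** * Orbits, faces and vertices *)

(** The certificate for both conclusions is a nonnegative cycle [w] on Q that vanishes exactly on
    the support of the matching. Pairing with [w] depends only on the class in N_o, is nonnegative
    on perfect matchings, and is zero on this one alone; hence [supported_extremal] and
    [supported_multiplicity_one]. The cycle comes from strong connectivity of the unmatched arrows
    ([forward_closed_full], [supporting_cycle]).

    Geometry enters through [corner_opposite], whose parallel rhombus sides give every flow a
    transverse vector and thereby fix the signs of all crossings ([intersection_form]), and through
    injectivity of the embedding, which determines successors in a flow ([flow_next]) and gives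
    primitivity ([strip_class_primitive]). Counting corners ([one_corner_per_face]) turns the
    resulting positive sectors into the perfect matchings [matching], and [P_coneE] identifies these
    with P(sigma). *)

Section PermutationOrbits.
Variables (T : finType) (p : {perm T}).

Lemma porbit_stable x y : (p y \in porbit p x) = (y \in porbit p x).
Proof. by rewrite -!eq_porbit_mem -{1}[p y]/((p ^+ 1)%g y) porbit_perm. Qed.

Lemma porbit_ind (P : T -> Prop) x :
  P x -> (forall y, y \in porbit p x -> P y -> P (p y)) ->
  forall y, y \in porbit p x -> P y.
Proof.
move=> Px PS y /porbitP[i ->]; elim: i => [|i IH]; first by rewrite perm1.
by rewrite expgSr permM; apply: PS => //; apply: mem_porbit.
Qed.

(** Once true, the predicate stays true, and iterating around the finite orbit comes back to the
    start. *)
Lemma porbit_const_bool (s : T -> bool) x :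
  (forall y, y \in porbit p x -> s y -> s (p y)) ->
  forall y, y \in porbit p x -> s y = s x.
Proof.
move=> sS y yx.
have fwd u v : u \in porbit p x -> v \in porbit p u -> s u -> s v.
  move=> ux vu su; move: v vu; apply: porbit_ind => // v vu; apply: sS.
  by move: ux vu; rewrite -!eq_porbit_mem => /eqP <-.
apply/idP/idP; last by apply: fwd; rewrite ?porbit_id.
by apply: (fwd y x) => //; rewrite porbit_sym.
Qed.

(** Used in the contrapositive: nothing can strictly increase all the way around an orbit. *)
Lemma porbit_argmax (R : realDomainType) (f : T -> R) x :
  exists2 y, y \in porbit p x & f (p y) <= f y.
Proof.
have [y yx ymax] := @arg_maxP _ _ _ _ (fun z => z \in porbit p x) f (porbit_id p x).
by exists y => //; apply: ymax; rewrite porbit_stable.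
Qed.

Lemma sum_porbit (V : nmodType) (F : T -> V) x :
  \sum_(y in porbit p x) F y = \sum_(i < #|porbit p x|) F ((p ^+ i)%g x).
Proof.
rewrite (eq_bigl (mem (traject p x #|porbit p x|))); last first.
  by move=> y /=; rewrite porbit_traject.
rewrite -big_uniq ?uniq_traject_porbit // (big_nth x) size_traject big_mkord.
by apply: eq_bigr => i _; rewrite nth_traject // permX.
Qed.

Lemma porbit_expE i x : ((p ^+ i)%g x == x) = (#|porbit p x| %| i)%N.
Proof.
have c0 : (0 < #|porbit p x|)%N by rewrite lt0n card_porbit_neq0.
have it k : (p ^+ (k * #|porbit p x|))%g x = x.
  elim: k => [|k IH]; first by rewrite perm1.
  by rewrite mulSnr expgD permM IH permX iter_porbit.
rewrite {1}(divn_eq i #|porbit p x|) expgD permM it.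
apply/eqP/idP => [E|/eqP ->]; last by rewrite perm1.
rewrite /dvdn; apply/eqP; move: (ltn_pmod i c0) E; set j := (_ %% _)%N => jc.
rewrite permX => E; move: (uniq_traject_porbit p x) => /(nth_uniq x).
move=> /(_ j 0); rewrite size_traject => /(_ jc c0).
by rewrite !nth_traject //= E eqxx => /esym /eqP.
Qed.

End PermutationOrbits.

Lemma row2P (K : Type) (u v : 'rV[K]_2) :
  u 0 0 = v 0 0 -> u 0 1 = v 0 1 -> u = v.
Proof.
move=> E0 E1; apply/rowP => j; case: (unliftP 0 j) => [i|] -> //.
by rewrite (ord1 i) (_ : lift 0 0 = 1) //; apply: val_inj.
Qed.

Section QuiverBasics.
Variable D : dimer_model.
Local Notation bn := (bnext D).
Local Notation wn := (wnext D).

Lemma face_subproof (c : bool) (a : arrow D) :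
  (c, porbit (next D c) a).2 \in porbits (next D (c, porbit (next D c) a).1).
Proof. exact: imset_f. Qed.

Definition face (c : bool) (a : arrow D) : Q2 D :=
  Sub (c, porbit (next D c) a) (face_subproof c a).

Lemma boundary_face c a : boundary (face c a) = porbit (next D c) a.
Proof. by []. Qed.

Lemma face_of_boundary (f : Q2 D) a :
  a \in boundary f -> f = face (val f).1 a.
Proof.
case: f => -[c S] /= fP; have /imsetP[b _ SE] := fP.
rewrite /boundary /= => aS; apply: val_inj => /=; congr (_, _).
by move: aS; rewrite SE -eq_porbit_mem => /eqP ->.
Qed.

Lemma boundary_nonempty (f : Q2 D) : exists a, a \in boundary f.
Proof.
case: f => -[c S] /= fP; have /imsetP[b _ SE] := fP.
by exists b; rewrite /boundary /= SE porbit_id.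
Qed.

(** Every arrow borders exactly one black and one white face. *)
Lemma sum_faces_at (V : nmodType) (F : Q2 D -> V) a :
  \sum_(f | a \in boundary f) F f = F (face true a) + F (face false a).
Proof.
rewrite (bigD1 (face true a)) ?boundary_face ?porbit_id //=; congr (_ + _).
rewrite (bigD1 (face false a)) ?boundary_face ?porbit_id //=.
rewrite big1 ?addr0 // => f /andP[/andP[af /eqP f1] /eqP f2].
have := face_of_boundary af; move: f1 f2.
by case: (val f).1 => f1 f2.
Qed.

Lemma sum_boundaries (V : nmodType) (G : bool -> arrow D -> V) :
  \sum_(f : Q2 D) \sum_(a in boundary f) G (val f).1 a =
  \sum_a (G true a + G false a).
Proof.
rewrite (exchange_big_dep predT) //=; apply: eq_bigr => a _.
by rewrite (sum_faces_at (fun f => G (val f).1 a)).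
Qed.

Lemma sum_at_vertices (V : nmodType) (G : arrow D -> V) (e : arrow D -> Q0 D) :
  \sum_(v : Q0 D) \sum_(a | e a == v) G a = \sum_a G a.
Proof. by rewrite (partition_big e predT). Qed.

Lemma tl_eq (a b : arrow D) : (tl a == tl b) = (a \in porbit (rot D) b).
Proof. by rewrite -val_eqE /= eq_porbit_mem. Qed.

Lemma vertex_tl (v : Q0 D) : exists a, v = tl a.
Proof.
case: v => S SP; have /imsetP[b _ SE] := SP.
by exists b; apply: val_inj.
Qed.

End QuiverBasics.

(** * Corners in a generic direction *)

Section PlaneForm.
Variables (R : realType) (e : R).
Implicit Types u v w r : 'rV[R]_2.

(** The constant [e] will compare the intersection pairing with the determinant. Its sign is not
    known in advance, so positions of directions are always tested with [form] rather than
    [det2]. *)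
Definition form u v : R := e * det2 u v.

Lemma form_anti u v : form v u = - form u v.
Proof. by rewrite /form /det2; ring. Qed.

Lemma formvv u : form u u = 0.
Proof. by rewrite /form /det2; ring. Qed.

Lemma formDl u v w : form (u + v) w = form u w + form v w.
Proof. by rewrite /form /det2 !mxE; ring. Qed.

Lemma formZl (c : R) u w : form (c *: u) w = c * form u w.
Proof. by rewrite /form /det2 !mxE; ring. Qed.

Lemma formNl u w : form (- u) w = - form u w.
Proof. by rewrite /form /det2 !mxE; ring. Qed.

Lemma formDr u v w : form w (u + v) = form w u + form w v.
Proof. by rewrite /form /det2 !mxE; ring. Qed.

Lemma formZr (c : R) u w : form w (c *: u) = c * form w u.
Proof. by rewrite /form /det2 !mxE; ring. Qed.

Lemma formNr u w : form w (- u) = - form w u.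
Proof. by rewrite /form /det2 !mxE; ring. Qed.

Lemma form_plucker u v w r :
  form u v * form w r + form u w * form r v + form u r * form v w = 0.
Proof. by rewrite /form /det2; ring. Qed.

(** The cotangent of the angle from [v] to [r], divided by [e]; it is strictly monotone in the angle
    on each side of the line of [v]. *)
Definition slope v r : R := (v 0 0 * r 0 0 + v 0 1 * r 0 1) / form v r.

Lemma slope_lt v r r' :
  0 < form v r * form v r' -> 0 < form r r' -> slope v r' < slope v r.
Proof.
move=> vv rr; have [vr0 vr'0] : form v r != 0 /\ form v r' != 0.
  by move: (lt0r_neq0 vv); rewrite mulf_eq0 negb_or => /andP[].
have nv : 0 < v 0 0 ^+ 2 + v 0 1 ^+ 2.
  rewrite lt0r addr_ge0 ?sqr_ge0 // andbT paddr_eq0 ?sqr_ge0 //.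
  apply/negP => /andP[]; rewrite !sqrf_eq0 => /eqP v0 /eqP v1.
  by move: vr0; rewrite /form /det2 v0 v1 !mul0r subrr mulr0 eqxx.
rewrite -subr_gt0.
have -> : slope v r - slope v r' =
    (v 0 0 ^+ 2 + v 0 1 ^+ 2) * form r r' / (form v r * form v r').
  rewrite /slope; move: vr0 vr'0; rewrite /form /det2 => vr0 vr'0; field.
  by move: vr0 vr'0; rewrite !mulf_eq0 !negb_or => /andP[-> ->] /andP[_ ->].
by rewrite divr_gt0 // mulr_gt0.
Qed.

(** Otherwise the sign of [form v] is constant on the orbit, so all the vectors stay on one side of
    [v], and their slopes decrease strictly all the way around. *)
Lemma winding_chain (T : finType) (p : {perm T}) (r : T -> 'rV[R]_2) v x :
  (forall y, 0 < form (r y) (r (p y))) -> (forall y, form v (r y) != 0) ->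
  exists y, [/\ y \in porbit p x, form v (r y) < 0 & 0 < form v (r (p y))].
Proof.
move=> rpos rgen; apply: contrapT => none.
have sS y : y \in porbit p x -> form v (r y) < 0 -> form v (r (p y)) < 0.
  move=> yx yn; rewrite lt_neqAle rgen leNgt; apply/negP => py.
  by apply: none; exists y.
have sC := porbit_const_bool sS.
have [y yx] := porbit_argmax p (fun y => - slope v (r y)) x.
rewrite lerN2; apply/negP; rewrite -ltNge; apply: slope_lt => //.
have py : p y \in porbit p x by rewrite porbit_stable.
have := sC _ yx; have := sC _ py => <-.
have := rgen y; have := rgen (p y); rewrite /=.
case: (ltrgtP (form v (r y)) 0) => // h1; case: (ltrgtP (form v (r (p y))) 0) => // h2 _ _ _.
  by rewrite nmulr_rgt0.
by rewrite mulr_gt0.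
Qed.

End PlaneForm.

Section Corners.
Variables (R : realType) (D : dimer_model) (e : R) (Z : arrow D -> 'rV[R]_2).
Local Notation bn := (bnext D).
Local Notation wn := (wnext D).
Local Notation form := (form e).
Implicit Types v : 'rV[R]_2.

(** When [Z a] is the class of the flow having [a] as an even arrow, this is the class of the flow
    having [a] as an odd arrow, since the preceding arrow on the black face is then even. *)
Definition Zback (a : arrow D) : 'rV[R]_2 := Z ((bn^-1)%g a).
Local Notation Y := Zback.

Definition ahead v a : bool := 0 < form v (Z a).
Definition generic v : Prop := forall a, form v (Z a) != 0.
(** For generic [v], this says that [v] lies in the open sector from [Zback Z a] to [Z a]; see
    [selectedE]. *)
Definition selected v a : bool := ~~ ahead v ((bn^-1)%g a) && ahead v a.
Local Notation B := selected.

Hypothesis Zw : forall a, Z (wn (bn a)) = Z a.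
Hypothesis Zpos : forall a, 0 < form (Y a) (Z a).

Lemma Zback_bn a : Y (bn a) = Z a.
Proof. by rewrite /Y permK. Qed.

Lemma Zback_wnV a : Y ((wn^-1)%g a) = Z a.
Proof. by rewrite /Y -[RHS](congr1 Z (permKV wn a)) -{2}[(wn^-1)%g a](permKV bn) Zw. Qed.

Lemma Z_wn a : Z (wn a) = Y a.
Proof. by rewrite -Zback_wnV permK. Qed.

Lemma ahead_wn v a : ahead v (wn a) = ahead v ((bn^-1)%g a).
Proof. by rewrite /ahead Z_wn. Qed.

Variable v : 'rV[R]_2.
Hypothesis v_gen : generic v.

Lemma aheadN a : ahead (- v) a = ~~ ahead v a.
Proof.
rewrite /ahead formNl oppr_gt0 -leNgt le_eqVlt.
by rewrite (negPf (v_gen a)).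
Qed.

Lemma notahead a : ~~ ahead v a = (form v (Z a) < 0).
Proof. by rewrite /ahead -leNgt le_eqVlt (negPf (v_gen a)). Qed.

(** With y and z for [Y a] and [Z a], the predicates [Wc], [Tc], [Hc] place [v] in the sectors
    (-y,-z), (z,-y), (-z,y), attached to the white, tail and head corners of the quadrilateral of
    [a]; [B] is the sector (y,z) of the black corner. *)
Let Wc a := ahead v ((bn^-1)%g a) && ~~ ahead v a.
Let Tc a := ~~ ahead v ((bn^-1)%g a) && ~~ ahead v a.
Let Hc a := ahead v ((bn^-1)%g a) && ahead v a.

Lemma black_corner x : exists2 a, a \in porbit bn x & B v a.
Proof.
have [||y [yx h1 h2]] := @winding_chain _ e _ bn Y v x.
- by move=> y; rewrite Zback_bn.
- by move=> y; apply: v_gen.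
by exists y => //; rewrite /B notahead h1 /ahead -Zback_bn.
Qed.

Lemma white_corner x : exists2 a, a \in porbit wn x & Wc a.
Proof.
have [||y [yx h1 h2]] := @winding_chain _ e _ (wn^-1)%g (fun a => - Y a) v x.
- by move=> y; rewrite Zback_wnV formNl formNr opprK.
- by move=> y; rewrite formNr oppr_eq0; apply: v_gen.
exists y; first by rewrite -porbitV.
rewrite /Wc notahead /ahead; move: h1 h2; rewrite Zback_wnV !formNr /Y.
by rewrite oppr_lt0 oppr_gt0 => -> ->.
Qed.

(** Around a vertex the directions [Z y], [- Z y'], [Z (rot D y)], with [y'] the black predecessor
    of [y], turn positively by less than a half turn each time. Without a tail or head corner
    containing [v] they would all stay on one side of [v], against the monotonicity of [slope]. *)
Lemma vertex_corner x :
  exists2 a, a \in porbit (rot D) x & Tc a || Hc ((bn^-1)%g a).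
Proof.
apply: contrapT => none.
have rotE y : rot D y = wn ((bn^-1)%g y) by rewrite /rot permM.
have ahead_rot y : ahead v (rot D y) = ahead v ((bn^-1)%g ((bn^-1)%g y)).
  by rewrite rotE ahead_wn.
have nc y : y \in porbit (rot D) x -> (Tc y = false) /\ Hc ((bn^-1)%g y) = false.
  move=> yx; split; apply/negP => h; apply: none; exists y => //.
    by rewrite h.
  by rewrite h orbT.
have sS y : y \in porbit (rot D) x -> ~~ ahead v y -> ~~ ahead v (rot D y).
  move=> yx; have [] := nc y yx; rewrite /Tc /Hc ahead_rot.
  by case: (ahead v y); case: (ahead v _); case: (ahead v _).
have sC := porbit_const_bool sS.
have [y yx] := porbit_argmax (rot D) (fun y => - slope e v (Z y)) x.
rewrite lerN2; apply/negP; rewrite -ltNge.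
have ryx : rot D y \in porbit (rot D) x by rewrite porbit_stable.
set y' := (bn^-1)%g y.
have rotY : ahead v ((bn^-1)%g y') = ahead v (rot D y) by rewrite ahead_rot.
have signs : 0 < form v (- Z y') * form v (Z y) /\
             0 < form v (- Z y') * form v (Z (rot D y)).
  have := sC _ ryx; have := nc y yx; rewrite -(sC _ yx).
  rewrite /Tc /Hc -/y' rotY formNr => -[].
  move=> h1 h2 h3; have {h1 h2 h3} [h1 h2] : ahead v (rot D y) = ahead v y /\
      ahead v y' = ~~ ahead v y.
    move: h1 h2 h3.
    by case: (ahead v y); case: (ahead v y'); case: (ahead v _) => // *; split.
  move: h1 h2; case h: (ahead v y) => h1 h2.
    have n2 : form v (Z y') < 0 by rewrite -notahead h2.
    by split; rewrite mulNr oppr_gt0 nmulr_rlt0.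
  have n1 : form v (Z y) < 0 by rewrite -notahead h.
  have n3 : form v (Z (rot D y)) < 0 by rewrite -notahead h1.
  by split; rewrite mulNr oppr_gt0 pmulr_rlt0.
have Yy : form (Y y) (Z y) > 0 := Zpos y.
apply: (@lt_trans _ _ (slope e v (- Z y'))); apply: slope_lt.
- by case: signs.
- rewrite formNl form_anti opprK rotE Z_wn; exact: Zpos.
- by rewrite mulrC; case: signs.
by rewrite formNr form_anti opprK.
Qed.

Let corners_at (w : Q0 D) : nat :=
  (\sum_(a | tl a == w) Tc a + \sum_(a | hd a == w) Hc a)%N.
Let corners_of (f : Q2 D) : nat :=
  (\sum_(a in boundary f) (if (val f).1 then B v a else Wc a))%N.

Lemma sum_nat_pos (T : finType) (P : pred T) (F : T -> bool) a :
  P a -> F a -> (0 < \sum_(b | P b) F b)%N.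
Proof. by move=> Pa Fa; rewrite (bigD1 a) //= Fa. Qed.

(* Every arrow has one of its four quadrilateral corners in the direction of  *)
(* v, every vertex and face has at least one such corner, and the torus has   *)
(* as many vertices and faces as arrows.                                      *)
Lemma one_corner_per_face f : corners_of f = 1%N.
Proof.
have at_ge1 w : (1 <= corners_at w)%N.
  have [x ->] := vertex_tl w; have [a ax /orP[ha|ha]] := vertex_corner x.
    by rewrite addn_gt0 (@sum_nat_pos _ _ _ a) // tl_eq.
  rewrite addn_gt0 orbC (@sum_nat_pos _ _ _ ((bn^-1)%g a)) //.
  by rewrite /hd permKV tl_eq.
have of_ge1 g : (1 <= corners_of g)%N.
  have [x] := boundary_nonempty g; rewrite /corners_of => xg.
  have gE := face_of_boundary xg; rewrite gE boundary_face /=.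
  case: (val g).1.
    by have [a ax Ba] := black_corner x; apply: (@sum_nat_pos _ _ _ a).
  by have [a ax Wa] := white_corner x; apply: (@sum_nat_pos _ _ _ a).
have total : (\sum_w corners_at w + \sum_g corners_of g = #|arrow D|)%N.
  rewrite /corners_at big_split /= !(@sum_at_vertices _ nat).
  rewrite /corners_of.
  rewrite (sum_boundaries (fun c a => nat_of_bool (if c then B v a else Wc a))) /=.
  rewrite -!big_split /= -sum1_card; apply: eq_bigr => a _.
  rewrite /Tc /Hc /B /Wc.
  by case: (ahead v a); case: (ahead v _).
move: total; rewrite -(dimer_torus D).
have h1 : (#|Q0 D| <= \sum_w corners_at w)%N by rewrite -sum1_card leq_sum.
have h2 : (#|Q2 D| <= \sum_g corners_of g)%N by rewrite -sum1_card leq_sum.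
move=> tot.
have E : (\sum_g corners_of g = \sum_(g : Q2 D) 1)%N.
  rewrite sum1_card; apply/eqP; rewrite eqn_leq h2 andbT.
  by rewrite -(leq_add2l (\sum_w corners_at w)) tot leq_add2r.
move: E; rewrite (bigD1 f) //= [in RHS](bigD1 f) //= => E.
have h3 : (\sum_(g : Q2 D | g != f) 1 <= \sum_(g | g != f) corners_of g)%N.
  exact: leq_sum.
by apply/eqP; rewrite eqn_leq of_ge1 andbT -(leq_add2r (\sum_(g | g != f) corners_of g)) E leq_add2l.
Qed.

End Corners.

(** * Perfect matchings attached to generic directions *)

Section SelectedArrows.
Variables (R : realType) (D : dimer_model) (e : R) (Z : arrow D -> 'rV[R]_2).
Local Notation bn := (bnext D).
Local Notation wn := (wnext D).
Local Notation form := (form e).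
Local Notation generic := (generic e Z).
Local Notation B := (selected e Z).
Local Notation Y := (Zback Z).
Hypothesis Zw : forall a, Z (wn (bn a)) = Z a.
Hypothesis Zpos : forall a, 0 < form (Y a) (Z a).
Implicit Types v : 'rV[R]_2.

Lemma genericN v : generic v -> generic (- v).
Proof. by move=> gv a; rewrite formNl oppr_eq0. Qed.

(** A white corner in direction [- v] is the same condition as a black corner in direction [v], so
    white faces are handled by the corner count for [- v]. *)
Lemma one_selected v (f : Q2 D) :
  generic v -> (\sum_(a in boundary f) B v a)%N = 1%N.
Proof.
move=> gv; case fc: (val f).1.
  rewrite -(one_corner_per_face Zw Zpos gv f); apply: eq_bigr => a _.
  by rewrite fc.
rewrite -(one_corner_per_face Zw Zpos (genericN gv) f); apply: eq_bigr => a _.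
by rewrite fc !(aheadN gv) negbK.
Qed.

Lemma selected_inj v (f : Q2 D) a b : generic v ->
  a \in boundary f -> b \in boundary f -> B v a -> B v b -> a = b.
Proof.
move=> gv af bf Ba Bb; apply/eqP; apply: contraT => ab.
have := one_selected f gv; rewrite (bigD1 a) //= (bigD1 b) /=; last first.
  by rewrite bf eq_sym.
by rewrite Ba Bb.
Qed.

Definition matching v : {ffun arrow D -> int} := [ffun a => (B v a : nat)%:Z].

Lemma matching_perfect v : generic v -> perfect_matching (matching v).
Proof.
move=> gv; split=> [a|]; first by rewrite ffunE.
apply/ffunP => f; rewrite !ffunE (eq_bigr (fun a => (B v a : nat)%:Z)); last first.
  by move=> a _; rewrite ffunE.
by rewrite -(big_morph Posz PoszD (erefl _)) (one_selected f gv).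
Qed.

Lemma selectedE v a : generic v ->
  B v a = (0 < form (Y a) v) && (0 < form v (Z a)).
Proof.
by move=> gv; rewrite /selected (notahead gv) [form v (Z ((bn^-1)%g a))]form_anti oppr_lt0.
Qed.

Lemma generic_combination u w : form u w != 0 ->
  exists T : R, forall t, T < t ->
    generic (u + t *: w) /\
    forall a, form w (Z a) != 0 -> 0 < form w (Z a) * form (u + t *: w) (Z a).
Proof.
move=> uw; exists (\sum_a `|form u (Z a) / form w (Z a)|) => t tT.
have tb a : `|form u (Z a) / form w (Z a)| < t.
  apply: le_lt_trans tT; rewrite (bigD1 a) //= lerDl.
  by apply: sumr_ge0 => *; apply: normr_ge0.
split=> a => [|wa]; rewrite formDl formZl.
  have := tb a; have [w0|w0] := eqVneq (form w (Z a)) 0.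
    move=> _; rewrite w0 mulr0 addr0; apply/eqP => u0.
    (* If [u] and [w] were both parallel to [Z a], this relation would force
       [form (Y a) (Z a) * form u w = 0]. *)
    have /eqP := form_plucker e (Y a) (Z a) u w; rewrite w0 (form_anti e u (Z a)).
    rewrite u0 !(oppr0, mulr0, addr0).
    by rewrite mulf_eq0 (negPf uw) orbF gt_eqF.
  rewrite normrM normfV ltr_pdivrMr ?normr_gt0 // => lt_t; apply/eqP => /eqP.
  rewrite addr_eq0 => /eqP E; move: lt_t; rewrite E normrN normrM.
  by rewrite ltr_pM2r ?normr_gt0 // ltNge ler_norm.
have := tb a; rewrite normrM normfV ltr_pdivrMr ?normr_gt0 // => h.
have : `|form w (Z a) * form u (Z a)| < t * form w (Z a) ^+ 2.
  by rewrite normrM -real_normK ?num_real // mulrC expr2 mulrA ltr_pM2r ?normr_gt0.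
by rewrite ltr_norml => /andP[]; lra.
Qed.

Lemma selected_somewhere a : exists2 v, generic v & B v a.
Proof.
have [T HT] := generic_combination (lt0r_neq0 (Zpos a)).
have mT : T < Num.max T 0 + 1.
  by rewrite (@le_lt_trans _ _ (Num.max T 0)) ?le_max ?lexx ?ltrDl.
have m0 : 0 < Num.max T 0 + 1.
  by rewrite (@le_lt_trans _ _ (Num.max T 0)) ?le_max ?lexx ?orbT ?ltrDl.
have [gv _] := HT _ mT; exists (Y a + (Num.max T 0 + 1) *: Z a) => //.
rewrite selectedE // formDr formDl formZr formZl !formvv mulr0 addr0 add0r.
by rewrite Zpos mulr_gt0.
Qed.

End SelectedArrows.

(** * Cocycles of zig-zag flows *)

Section Homology.
Variables (D : dimer_model) (H : homology_marking D).
Local Notation bn := (bnext D).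
Local Notation wn := (wnext D).

Lemma arrows_connected (T : Type) (f : arrow D -> T) :
  (forall a, f (bn a) = f a) -> (forall a, f (wn a) = f a) ->
  forall a b, f a = f b.
Proof.
move=> fb fw a b; pose S := [set c | `[< f c = f a >]].
have sub : (<<[set bn; wn]>> \subset 'N(S | 'P))%g.
  rewrite gen_subG; apply/fintype.subsetP => p pin; rewrite !inE /=.
  apply/fintype.subsetP => c; rewrite !inE /= /aperm => fc.
  by move: pin; rewrite !inE => /orP[] /eqP ->; [rewrite fb | rewrite fw].
have /imsetP[x _ xE] := dimer_connected D.
have : b \in orbit 'P <<[set bn; wn]>>%g a.
  have aE : a \in orbit 'P <<[set bn; wn]>>%g x by rewrite -xE inE.
  by rewrite (orbit_eqP aE) -xE inE.
case/orbitP => g gG <-; have aS : a \in S by rewrite inE; apply/asboolP.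
have : aperm a g \in S.
  have := astabs_act a (fintype.subsetP sub _ gG); rewrite aS; exact: id.
by rewrite inE => /asboolW <-.
Qed.

(** One black and one white step of a zig-zag path: the orbits of [zeta] are the zig-zag paths, each
    recorded by its even arrows. *)
Definition zeta : {perm arrow D} := (bn * wn)%g.

Lemma zetaE a : zeta a = wn (bn a).
Proof. by rewrite permM. Qed.

Definition strip_class (a : arrow D) : 'rV[int]_2 :=
  \sum_(b in porbit zeta a) (shift H b + shift H (bn b)).

Lemma strip_class_zeta a : strip_class (wn (bn a)) = strip_class a.
Proof.
rewrite /strip_class; have /eqP -> // : porbit zeta (wn (bn a)) == porbit zeta a.
by rewrite eq_porbit_mem -zetaE porbit_stable porbit_id.
Qed.

Definition chain_class (w : arrow D -> int) : 'rV[int]_2 := \sum_a shift H a *~ w a.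

Definition is_closed (c : arrow D -> int) : Prop :=
  forall f : Q2 D, \sum_(b in boundary f) c b = 0.

Lemma is_cycleB (w w' : arrow D -> int) : is_cycle w -> is_cycle w' -> is_cycle (fun a => w a - w' a).
Proof. by move=> cw cw' v; rewrite !sumrB cw cw'. Qed.

Lemma is_cycleZ k (w : arrow D -> int) : is_cycle w -> is_cycle (fun a => k * w a).
Proof. by move=> cw v; rewrite -!mulr_sumr cw. Qed.

Lemma is_cycleD (w w' : arrow D -> int) : is_cycle w -> is_cycle w' -> is_cycle (fun a => w a + w' a).
Proof. by move=> cw cw' v; rewrite !big_split /= cw cw'. Qed.

Lemma is_cycle_sum (I : finType) (P : pred I) (F : I -> arrow D -> int) :
  (forall i, P i -> is_cycle (F i)) -> is_cycle (fun a => \sum_(i | P i) F i a).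
Proof.
move=> cF v; rewrite exchange_big [RHS]exchange_big /=.
by apply: eq_bigr => i Pi; apply: cF.
Qed.

Lemma chain_classB w w' :
  chain_class (fun a => w a - w' a) = chain_class w - chain_class w'.
Proof. by rewrite /chain_class -sumrB; apply: eq_bigr => a _; rewrite mulrzBr. Qed.

Lemma chain_classZ k w : chain_class (fun a => k * w a) = chain_class w *~ k.
Proof.
rewrite /chain_class mulrz_suml; apply: eq_bigr => a _.
by rewrite mulrC mulrzA.
Qed.

Lemma chain_classD w w' :
  chain_class (fun a => w a + w' a) = chain_class w + chain_class w'.
Proof. by rewrite /chain_class -big_split; apply: eq_bigr => a _; rewrite mulrzDr. Qed.

Lemma chain_class_sum (I : finType) (P : pred I) (F : I -> arrow D -> int) :
  chain_class (fun a => \sum_(i | P i) F i a) = \sum_(i | P i) chain_class (F i).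
Proof.
rewrite /chain_class exchange_big /=; apply: eq_bigr => a _.
by rewrite -mulrz_sumr.
Qed.

Lemma row2_delta (m : 'rV[int]_2) :
  m = delta_mx 0 0 *~ m 0 0 + delta_mx 0 1 *~ m 0 1.
Proof.
rewrite -!scaler_int !intz; apply: row2P; rewrite !mxE /=.
  by rewrite mulr0 mulr1 addr0.
by rewrite mulr0 mulr1 add0r.
Qed.

(** By [shift_inj] a null-homologous cycle is a combination of face boundaries, on which a closed
    cochain vanishes. *)
Lemma closed_pairing0 c w : is_closed c -> is_cycle w -> chain_class w = 0 ->
  \sum_a c a * w a = 0.
Proof.
move=> cc cw w0; have [d wE] := shift_inj cw w0.
under eq_bigr => a _ do rewrite wE mulr_sumr.
rewrite (exchange_big_dep predT) //= big1 // => f _.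
by rewrite -mulr_suml cc mul0r.
Qed.

Lemma closed_pairing_linear c : is_closed c -> exists p q : int,
  forall w, is_cycle w ->
    \sum_a c a * w a = p * chain_class w 0 0 + q * chain_class w 0 1.
Proof.
move=> cc.
have [w0 cw0 w0E] := shift_onto H (delta_mx 0 0).
have [w1 cw1 w1E] := shift_onto H (delta_mx 0 1).
exists (\sum_a c a * w0 a), (\sum_a c a * w1 a) => w cw.
set k0 := chain_class w 0 0; set k1 := chain_class w 0 1.
have /(closed_pairing0 cc) :
    is_cycle (fun a => w a - (k0 * w0 a + k1 * w1 a)).
  by apply: is_cycleB => //; apply: is_cycleD; apply: is_cycleZ.
have [{}w0E {}w1E] : chain_class w0 = delta_mx 0 0 /\ chain_class w1 = delta_mx 0 1 by [].
rewrite chain_classB chain_classD !chain_classZ w0E w1E => h.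
have E : \sum_a c a * (w a - (k0 * w0 a + k1 * w1 a)) =
  \sum_a c a * w a - ((\sum_a c a * w0 a) * k0 + (\sum_a c a * w1 a) * k1).
  rewrite !mulr_suml -big_split /= -sumrB; apply: eq_bigr => a _; ring.
apply/eqP; rewrite -subr_eq0 -E; apply/eqP; apply: h.
by rewrite {1}(row2_delta (chain_class w)) subrr.
Qed.

(** The cocycle of the zig-zag path in which [a] is even: 1 on its even arrows, -1 on its odd ones.
    The path itself, as a 1-cycle, is [strip_chain]. *)
Definition strip (a b : arrow D) : int :=
  ((b \in porbit zeta a) : nat)%:Z - (((bn^-1)%g b \in porbit zeta a) : nat)%:Z.

Definition strip_chain (a b : arrow D) : int :=
  ((b \in porbit zeta a) : nat)%:Z + (((bn^-1)%g b \in porbit zeta a) : nat)%:Z.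

(** On a black face each even arrow is followed by an odd one, on a white face each odd arrow by an
    even one, so the signs cancel in pairs. *)
Lemma strip_closed a : is_closed (strip a).
Proof.
move=> f; rewrite /strip sumrB; apply/eqP; rewrite subr_eq0; apply/eqP.
have [x xf] := boundary_nonempty f; rewrite (face_of_boundary xf) boundary_face.
case: (val f).1 => /=.
  rewrite [RHS](reindex_inj (@perm_inj _ bn)) /=.
  by apply: eq_big => [b|b _]; rewrite ?porbit_stable ?permK.
rewrite (reindex_inj (@perm_inj _ wn)) /=.
apply: eq_big => [b|b _]; first by rewrite porbit_stable.
by rewrite -{1}[b](permKV bn) -zetaE porbit_stable.
Qed.

Lemma strip_chain_cycle a : is_cycle (strip_chain a).
Proof.
move=> v; rewrite /strip_chain !big_split /= addrC; congr (_ + _).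
  rewrite [RHS](reindex_inj (@perm_inj _ wn)) /=.
  apply: eq_big => [b|b _]; first by rewrite (hd_next false).
  by rewrite -{2}[b](permKV bn) -zetaE porbit_stable.
rewrite [RHS](reindex_inj (@perm_inj _ bn)) /=.
by apply: eq_bigr => b _; rewrite permK.
Qed.

Lemma strip_chain_class a : chain_class (strip_chain a) = strip_class a.
Proof.
rewrite /chain_class /strip_class big_split /=.
under eq_bigr => b _ do rewrite mulrzDr.
rewrite big_split /=; congr (_ + _).
  rewrite [RHS]big_mkcond /=; apply: eq_bigr => b _.
  by case: (_ \in _); rewrite ?mulr1z ?mulr0z.
rewrite (reindex_inj (@perm_inj _ bn)) [RHS]big_mkcond /=; apply: eq_bigr => b _.
by rewrite permK; case: (_ \in _); rewrite ?mulr1z ?mulr0z.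
Qed.

(** Counts the arrows that are even on the path of [a] and odd on the path of [a'], that is,
    crossings in one direction. *)
Definition crossings (a a' : arrow D) : nat :=
  (\sum_b ((b \in porbit zeta a) && ((bn^-1)%g b \in porbit zeta a')))%N.

Lemma strip_pairing_crossings a a' :
  \sum_b strip a b * strip_chain a' b = (crossings a a')%:Z - (crossings a' a)%:Z.
Proof.
rewrite /crossings !(big_morph Posz PoszD (erefl _)).
(* Arrows even on both paths cancel against arrows odd on both, since [bn] matches the two sets. *)
pose F b := (((b \in porbit zeta a) && (b \in porbit zeta a')) : nat)%:Z.
have h : \sum_b F b - \sum_b F ((bn^-1)%g b) = 0.
  by rewrite (reindex_inj (@perm_inj _ (bn^-1)%g)) subrr.
rewrite -[RHS]addr0 -[X in _ = _ + X]h /F.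
rewrite -!sumrB -big_split /=; apply: eq_bigr => b _.
rewrite /strip /strip_chain.
by do 4!case: (_ \in _).
Qed.

End Homology.

(** * The intersection form on zig-zag classes *)

(** Two functionals vanishing on z and y respectively, with opposite nonzero values on the other
    vector, are the determinants against z and y with one common factor. Antisymmetry of the pairing
    supplies the opposite values. *)
Lemma dual_functionals (R : realFieldType) (p q p' q' y0 y1 z0 z1 n : R) :
  0 < n -> p * y0 + q * y1 = n -> p * z0 + q * z1 = 0 ->
  p' * y0 + q' * y1 = 0 -> p' * z0 + q' * z1 = - n ->
  y0 * z1 - y1 * z0 != 0 /\
  forall x0 x1,
    (p * x0 + q * x1) * (y0 * z1 - y1 * z0) = n * (x0 * z1 - x1 * z0) /\
    (p' * x0 + q' * x1) * (y0 * z1 - y1 * z0) = n * (x0 * y1 - x1 * y0).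
Proof.
move=> n0 py pz p'y p'z; split.
  have : n * n = (y0 * z1 - y1 * z0) * (p' * q - q' * p).
    have -> : n * n = - ((p * y0 + q * y1) * (p' * z0 + q' * z1)).
      by rewrite py p'z mulrN opprK.
    rewrite -[LHS](addr0 _) -[X in _ + X](mul0r (p' * y0 + q' * y1)) -pz; ring.
  by apply: contra_eqN => /eqP ->; rewrite mul0r gt_eqF ?mulr_gt0.
move=> x0 x1; split; apply/eqP; rewrite -subr_eq0; apply/eqP.
  rewrite -py -[RHS](mul0r (- (x0 * y1 - x1 * y0))) -pz; ring.
have -> : n = - (p' * z0 + q' * z1) by rewrite p'z opprK.
rewrite -[RHS](mul0r (- (z0 * x1 - z1 * x0))) -p'y; ring.
Qed.

Section IntersectionForm.
Variables (R : realType) (D : dimer_model) (H : homology_marking D).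
Local Notation bn := (bnext D).
Local Notation wn := (wnext D).

Definition strip_vector (a : arrow D) : 'rV[R]_2 := toR R (strip_class H a).
Local Notation Z := strip_vector.

Lemma strip_vector_zeta a : Z (wn (bn a)) = Z a.
Proof. by rewrite /Z strip_class_zeta. Qed.

Lemma porbit_zeta_wn a : porbit (zeta D) (wn a) = porbit (zeta D) ((bn^-1)%g a).
Proof.
apply/eqP; rewrite eq_porbit_mem -{1}[a](permKV bn) -zetaE porbit_stable.
exact: porbit_id.
Qed.

(* W a is the common transverse vector of the rhombi along the zig-zag flow   *)
(* that has a as an even arrow; two flows can only cross in the direction     *)
(* given by their transverse vectors.                                         *)
Variable W : arrow D -> 'rV[R]_2.
Hypothesis W_zeta : forall a, W (wn (bn a)) = W a.
Hypothesis W_pos : forall a, 0 < det2 (W ((bn^-1)%g a)) (W a).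

Lemma W_porbit a b : b \in porbit (zeta D) a -> W b = W a.
Proof.
apply: (porbit_ind (P := fun b => W b = W a)) => // y _.
by rewrite zetaE W_zeta.
Qed.

Lemma crossings_pos a a' : (0 < crossings a a')%N -> 0 < det2 (W a') (W a).
Proof.
rewrite lt0n; apply: contraNT => neg; rewrite sum_nat_eq0; apply/forallP => b.
apply/implyP => _; rewrite eqb0; apply/negP => /andP[ba ba'].
by move: neg; rewrite -(W_porbit ba) -(W_porbit ba') W_pos.
Qed.

Let pairing (a : arrow D) (w : arrow D -> int) : R := (\sum_b strip a b * w b)%:~R.
Let back (a : arrow D) := (bn^-1)%g a.

Lemma pairing_linear a : exists p q : R, forall w, is_cycle w ->
  pairing a w = p * toR R (chain_class H w) 0 0 + q * toR R (chain_class H w) 0 1.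
Proof.
have [p [q pq]] := closed_pairing_linear H (strip_closed a).
exists p%:~R, q%:~R => w cw; rewrite /pairing pq // !mxE.
by rewrite rmorphD !rmorphM.
Qed.

Lemma pairing_self a : pairing a (strip_chain a) = 0.
Proof. by rewrite /pairing strip_pairing_crossings subrr. Qed.

Lemma pairing_anti a a' :
  pairing a' (strip_chain a) = - pairing a (strip_chain a').
Proof. by rewrite /pairing !strip_pairing_crossings -rmorphN opprB. Qed.

(** The arrow [a] is itself a crossing, and a crossing in the other direction would reverse the sign
    of the determinant of the transverse vectors. *)
Lemma pairing_back a : 0 < pairing a (strip_chain (back a)).
Proof.
rewrite /pairing strip_pairing_crossings.
have pos : (0 < crossings a (back a))%N.
  by rewrite /crossings (bigD1 a) //= !porbit_id.
have -> : crossings (back a) a = 0%N.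
  apply/eqP; rewrite -leqn0 leqNgt; apply/negP => /crossings_pos.
  rewrite /det2; have := crossings_pos pos; rewrite /det2; lra.
by rewrite subr0 ltr0z.
Qed.

Lemma toR_strip_chain a : toR R (chain_class H (strip_chain a)) = Z a.
Proof. by rewrite strip_chain_class. Qed.

Lemma pairing_form a :
  det2 (Z (back a)) (Z a) != 0 /\
  forall w, is_cycle w ->
    pairing a w * det2 (Z (back a)) (Z a) =
      pairing a (strip_chain (back a)) * det2 (toR R (chain_class H w)) (Z a) /\
    pairing (back a) w * det2 (Z (back a)) (Z a) =
      pairing a (strip_chain (back a)) *
        det2 (toR R (chain_class H w)) (Z (back a)).
Proof.
have [p [q pq]] := pairing_linear a.
have [p' [q' pq']] := pairing_linear (back a).
have ca := strip_chain_cycle a; have cb := strip_chain_cycle (back a).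
have N := pairing_back a.
have e1 := pairing_self a; have e2 := pairing_self (back a).
have e3 := pairing_anti a (back a).
move: N e1 e2 e3; set n := pairing a (strip_chain (back a)).
have nE : pairing a (strip_chain (back a)) = n by [].
move: nE; rewrite !pq // !pq' // !toR_strip_chain => nE n0 e1 e2 e3.
have [d0 dx] := dual_functionals n0 nE e1 e2 e3.
split=> // w cw; rewrite pq // pq' //; exact: dx.
Qed.

Lemma intersection_form : exists e : R,
  (forall a, 0 < form e (Zback Z a) (Z a)) /\
  (forall a w, is_cycle w ->
    (\sum_b strip a b * w b)%:~R = form e (toR R (chain_class H w)) (Z a)).
Proof.
(* The factor [k a] serves both flows through [a]. Comparing the two descriptions of one flow shows
   that [k] is invariant under [bn] and [wn], hence constant by connectedness. *)
pose k a := pairing a (strip_chain (back a)) / det2 (Z (back a)) (Z a).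
have kP a w : is_cycle w -> pairing a w = k a * det2 (toR R (chain_class H w)) (Z a).
  move=> cw; have [d0 /(_ w cw)[h _]] := pairing_form a.
  by rewrite /k mulrAC -h mulfK.
have kbackP a w : is_cycle w ->
    pairing (back a) w = k a * det2 (toR R (chain_class H w)) (Z (back a)).
  move=> cw; have [d0 /(_ w cw)[_ h]] := pairing_form a.
  by rewrite /k mulrAC -h mulfK.
have d0 a : det2 (Z a) (Z (back a)) != 0.
  by have [+ _] := pairing_form a; rewrite /det2 -oppr_eq0 opprB mulrC [X in _ - X]mulrC.
have kback a : k (back a) = k a.
  have ca := strip_chain_cycle a; have := kP (back a) _ ca; rewrite kbackP //.
  by rewrite toR_strip_chain => /(mulIf (d0 a)).
have kwn a : k (wn a) = k a.
  have ca := strip_chain_cycle a; have := kP (wn a) _ ca.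
  rewrite /pairing /strip porbit_zeta_wn -/(pairing _ _) kbackP //.
  have -> : Z (wn a) = Z (back a) by rewrite -{1}[a](permKV bn) strip_vector_zeta.
  by rewrite toR_strip_chain => /(mulIf (d0 a)).
have kbn a : k (bn a) = k a by rewrite -kback /back permK.
case: (pickP (@predT (arrow D))) => [a0 _|none]; last first.
  by exists 0; split=> a; have := none a.
have kC a : k a = k a0 by exact: (arrows_connected kbn kwn).
exists (k a0); split=> [a|a w cw]; rewrite /form -(kC a).
  have := pairing_back a; rewrite kP; last exact: strip_chain_cycle.
  by rewrite toR_strip_chain.
exact: kP.
Qed.

End IntersectionForm.

(** * Cycles avoiding the selected arrows *)

Section BalancedChains.
Variables (V E : finType) (src dst : E -> V).

Lemma indicator_sum (P : pred E) a : (\sum_(b | P b) (a == b) = P a)%N.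
Proof.
rewrite big_mkcond (bigD1 a) //= eqxx big1 ?addn0; first by case: (P a).
by move=> b ba; rewrite eq_sym (negPf ba); case: (P b).
Qed.

(** Following [s] inside the finite set [X] eventually repeats a vertex; [w] counts the arrows of
    the resulting loop. *)
Lemma recurrent_chain (X : {set V}) (s : V -> E) x0 :
  (forall x, x \in X -> src (s x) = x /\ dst (s x) \in X) -> x0 \in X ->
  exists w : E -> nat,
    [/\ forall x, (\sum_(a | dst a == x) w a = \sum_(a | src a == x) w a)%N,
        exists a, (0 < w a)%N
      & forall a, w a != 0%N -> src a \in X /\ a = s (src a)].
Proof.
move=> sX x0X; pose g x := dst (s x).
have gX x k : x \in X -> iter k g x \in X.
  by move=> xX; elim: k => //= k /sX[].
have : ~~ injectiveb (fun i : 'I_(#|V|.+1) => iter i g x0).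
  apply/negP => /injectiveP /leq_card; by rewrite card_ord ltnn.
case/injectivePn => i0 [j0 ij0 Eij0].
have [i [j [ij Eij]]] : exists i j : nat, (i < j)%N /\ iter i g x0 = iter j g x0.
  by case: (ltngtP i0 j0) ij0 => // [lt _|lt _|/val_inj ->];
     [exists i0, j0|exists j0, i0|rewrite eqxx].
set x1 := iter i g x0 in Eij; have x1X : x1 \in X by apply: gX.
have loop : iter (j - i) g x1 = x1 by rewrite -iterD subnK // ltnW.
pose w a := (\sum_(k < j - i) (s (iter k g x1) == a))%N.
have n0 : (0 < j - i)%N by rewrite subn_gt0.
exists w; split=> [x||a].
- rewrite /w (exchange_big_dep predT) //= [RHS](exchange_big_dep predT) //=.
  under eq_bigr => k _ do rewrite indicator_sum andbT.
  under [RHS]eq_bigr => k _ do rewrite indicator_sum andbT (proj1 (sX _ (gX _ _ x1X))).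
  have E1 : (\sum_(k < j - i) (dst (s (iter k g x1)) == x) =
             \sum_(k < j - i) (iter k.+1 g x1 == x))%N by [].
  rewrite E1 -(prednK n0) big_ord_recr [RHS]big_ord_recl /= addnC.
  by move: loop; rewrite -(prednK n0) iterS => ->.
- by exists (s x1); rewrite /w (bigD1 (Ordinal n0)) //= eqxx.
rewrite sum_nat_eq0 => /forallPn[k]; rewrite eqb0 negbK /= => /eqP <-.
by have [-> _] := sX _ (gX _ k x1X); split=> //; apply: gX.
Qed.

Lemma walk_chain (P : pred E) x y :
  connect (fun x y => [exists a, [&& P a, src a == x & dst a == y]]) x y ->
  exists w : E -> nat,
    (forall z, (\sum_(a | dst a == z) w a + (x == z) =
               \sum_(a | src a == z) w a + (y == z))%N) /\
    forall a, w a != 0%N -> P a.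
Proof.
case/connectP => p; elim: p x => [|x' p IH] x /=.
  by move=> _ ->; exists (fun=> 0%N); split=> // z; rewrite !big1.
case/andP => /existsP[a /and3P[Pa /eqP ax /eqP ax']] px' yl.
have [w [wb wP]] := IH _ px' yl.
exists (fun b => w b + (a == b))%N; split=> [z|b]; last first.
  by rewrite addn_eq0 negb_and => /orP[/wP //|]; rewrite eqb0 negbK => /eqP <-.
rewrite !big_split /= !indicator_sum /= ax ax' wb.
by rewrite -!addnA [((x == z) + _)%N]addnC.
Qed.

End BalancedChains.

(** * Strong connectivity of the complement of a matching *)

Section StrongConnectivity.
Variables (R : realType) (D : dimer_model) (H : homology_marking D) (e : R).
Local Notation bn := (bnext D).
Local Notation wn := (wnext D).
Local Notation Z := (strip_vector R H).
Local Notation form := (form e).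
Local Notation B := (selected e Z).
Hypothesis Zpos : forall a, 0 < form (Zback Z a) (Z a).
Hypothesis strip_form : forall a w, is_cycle w ->
  (\sum_b strip a b * w b)%:~R = form (toR R (chain_class H w)) (Z a).
Variable v : 'rV[R]_2.
Hypothesis v_gen : generic e Z v.

Let Zw := strip_vector_zeta R H.

(** The tail or head corner in direction [v] at the vertex rules out the black corners of both an
    outgoing arrow and its black predecessor, which is incoming. *)
Lemma vertex_exit_entry (x : Q0 D) :
  (exists2 a, tl a = x & ~~ B v a) /\ (exists2 a, hd a = x & ~~ B v a).
Proof.
have [y ->] := vertex_tl x.
have [a ay aTH] := vertex_corner Zw Zpos v_gen y.
have ta : tl a = tl y by apply/eqP; rewrite tl_eq.
split.
  exists a => //; move: aTH; rewrite /selected.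
  by case: (ahead e Z v a); case: (ahead e Z v ((bn^-1)%g a)); rewrite ?andbF.
exists ((bn^-1)%g a); first by rewrite /hd permKV.
move: aTH; rewrite /selected.
by case: (ahead e Z v a); case: (ahead e Z v ((bn^-1)%g a)); case: (ahead e Z v _).
Qed.

Lemma form_const_neq0 (a : arrow D) : e != 0.
Proof. by have := lt0r_neq0 (Zpos a); rewrite /form mulf_eq0 negb_or => /andP[]. Qed.

(** The arrow [a0] lies on the matching of some [v']. The difference of two perfect matchings is
    closed, yet its pairing with [w] is positive, so [w] cannot be null-homologous. *)
Lemma avoiding_cycle_class w a0 : is_cycle w -> (forall a, 0 <= w a) ->
  0 < w a0 -> (forall a, w a != 0 -> ~~ B v a) -> chain_class H w != 0.
Proof.
move=> cw w0 wa0 wB; apply/eqP => class0.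
have [v' gv' Ba0] := selected_somewhere Zpos a0.
have closed : is_closed (fun a => matching e Z v' a - matching e Z v a).
  move=> f; rewrite sumrB.
  have [_ /ffunP /(_ f)] := matching_perfect Zw Zpos gv'.
  have [_ /ffunP /(_ f)] := matching_perfect Zw Zpos v_gen.
  by rewrite !ffunE => -> ->; rewrite subrr.
have := closed_pairing0 closed cw class0.
under eq_bigr => a _ do rewrite mulrBl; rewrite sumrB.
rewrite [X in _ - X]big1 ?subr0 => [|a _]; last first.
  have [->|/wB nB] := eqVneq (w a) 0; first by rewrite mulr0.
  by rewrite ffunE (negPf nB) mul0r.
apply/eqP; rewrite gt_eqF // (bigD1 a0) //= ffunE Ba0 mul1r.
rewrite ltr_wpDr // sumr_ge0 // => a _.
by rewrite mulr_ge0 // ffunE.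
Qed.

Lemma form_basis u a a' : form (Z a) (Z a') != 0 -> u != 0 ->
  form u (Z a) != 0 \/ form u (Z a') != 0.
Proof.
move=> aa' u0.
have [h|] := eqVneq (form u (Z a)) 0; last by left.
have [h'|] := eqVneq (form u (Z a')) 0; last by right.
have u_ r : form u r = 0.
  have := form_plucker e u (Z a) (Z a') r; rewrite h h' !mul0r !add0r => /eqP.
  by rewrite mulf_eq0 (negPf aa') orbF => /eqP.
have e0 := form_const_neq0 a.
case/negP: u0; apply/eqP/row2P; rewrite mxE.
  have := u_ (delta_mx 0 1); rewrite /form /det2 !mxE /= mulr0 mulr1 subr0 => /eqP.
  by rewrite mulf_eq0 (negPf e0) => /eqP.
have := u_ (delta_mx 0 0); rewrite /form /det2 !mxE /= mulr0 mulr1 sub0r => /eqP.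
by rewrite mulf_eq0 (negPf e0) oppr_eq0 => /eqP.
Qed.

Variables a1 a2 : arrow D.
Hypothesis a12 : form (Z a1) (Z a2) != 0.
(** Each black face along the zig-zag path is matched inside the path, so the rest of its boundary
    avoids the matching. *)
Let on_strip a := forall b, b \in porbit (zeta D) a -> B v b || B v (bn b).
Hypothesis sel1 : on_strip a1.
Hypothesis sel2 : on_strip a2.

Section ForwardClosed.
Variable A : {set Q0 D}.
Hypothesis A_fwd : forall a, ~~ B v a -> tl a \in A -> hd a \in A.

(** The unique selected arrow of the face sits at position 0 or 1, so positions 2 and beyond can be
    followed without leaving [A]. *)
Lemma face_walk b i j : B v b || B v (bn b) ->
  (2 <= i)%N -> (i <= j)%N -> (j <= #|porbit bn b|)%N ->
  tl ((bn ^+ i)%g b) \in A -> tl ((bn ^+ j)%g b) \in A.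
Proof.
move=> sb i2 ij; rewrite -(subnKC ij); elim: (j - i)%N => [|k IH].
  by rewrite addn0.
rewrite addnS => lt iA; have {}IH := IH (ltnW lt) iA.
have -> : tl ((bn ^+ (i + k).+1)%g b) = hd ((bn ^+ (i + k))%g b).
  by rewrite expgSr permM.
apply: A_fwd => //; apply/negP => sk.
have neq n : (0 < n)%N -> (n < #|porbit bn b|)%N -> (bn ^+ n)%g b != b.
  by move=> n0 nlt; rewrite porbit_expE; apply/negP => /(dvdn_leq n0); rewrite leqNgt nlt.
have inf n : (bn ^+ n)%g b \in boundary (face true b).
  by rewrite boundary_face; apply: mem_porbit.
case/orP: sb => sb.
  have := neq (i + k)%N; rewrite -(selected_inj Zw Zpos v_gen (inf 0%N) (inf _) _ sk) ?perm1 //.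
  by rewrite eqxx lt => /(_ _ _)/negP; case => //; lia.
have ik : (i + k = (i + k).-1.+1)%N by lia.
have := selected_inj Zw Zpos v_gen (inf 1%N) (inf (i + k)%N).
rewrite expg1 => /(_ sb sk); rewrite ik expgSr permM => /perm_inj E.
have := neq (i + k).-1; rewrite -E eqxx => /(_ _ _)/negP; case => //; lia.
Qed.

Lemma face_card_ge2 b : (2 <= #|porbit bn b|)%N.
Proof.
rewrite ltn_neqAle lt0n card_porbit_neq0 andbT.
apply/negP => /eqP/esym c1; have /eqP := dimer_valence true b; apply => /=.
by apply/eqP; rewrite -[bn b]/((bn ^+ 1)%g b) porbit_expE c1.
Qed.

Lemma tl_exp2 b : tl ((bn ^+ 2)%g b) = tl (zeta D b).
Proof. by rewrite zetaE -(hd_next false) permX. Qed.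

(** The unselected part of the black face of [b] leads from the tail of [zeta D b] back to the tail
    of [b]. Membership in [A] thus propagates backwards along the periodic path and is constant. *)
Lemma strip_status a b : on_strip a -> b \in porbit (zeta D) a ->
  (tl b \in A) = (tl a \in A).
Proof.
move=> sa ba; apply: negb_inj.
apply: (@porbit_const_bool _ (zeta D) (fun b => tl b \notin A) a _ b ba).
move=> {ba}b /sa sb; apply: contra; rewrite -tl_exp2 => h.
have := face_walk sb (leqnn 2) (face_card_ge2 b) (leqnn _) h.
by rewrite permX iter_porbit.
Qed.

Lemma strip_status_meet a c : on_strip a -> strip a c != 0 ->
  (tl c \in A) = (hd c \in A) -> (tl a \in A) = (tl c \in A).
Proof.
move=> sa sc ch.
have [ca|ca] := boolP (c \in porbit (zeta D) a); first by rewrite (strip_status sa ca).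
move: sc; rewrite /strip (negPf ca) sub0r oppr_eq0 eqz_nat eqb0 negbK => ca'.
rewrite ch -[c](permKV bn) (hd_next false) /= -zetaE.
by rewrite (@strip_status a (zeta D _)) // porbit_stable.
Qed.

Lemma cycle_meets_strip a w (beta : bool) : on_strip a -> is_cycle w ->
  form (toR R (chain_class H w)) (Z a) != 0 ->
  (forall c, w c != 0 -> (tl c \in A) = beta /\ (hd c \in A) = beta) ->
  (tl a \in A) = beta.
Proof.
move=> sa cw; rewrite -strip_form // intr_eq0 => ne wA.
have [c] : exists c, strip a c * w c != 0.
  apply: contrapT => none; case/negP: ne; apply/eqP; apply: big1 => c _.
  by apply/eqP; apply: contrapT => /negP h; apply: none; exists c.
rewrite mulf_eq0 negb_or => /andP[sc /wA[tc hc]].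
by rewrite (strip_status_meet sa sc) tc // hc.
Qed.

(** The other side of the black faces along the path: their boundaries minus the path itself, a
    cycle of class opposite to that of the path. *)
Definition black_boundary (a c : arrow D) : int :=
  \sum_(b in porbit (zeta D) a) ((c \in porbit bn b) : nat)%:Z - strip_chain a c.

Lemma face_cycle b : is_cycle (fun c => ((c \in porbit bn b) : nat)%:Z).
Proof.
move=> x; rewrite [RHS](reindex_inj (@perm_inj _ bn)) /=.
by apply: eq_bigr => c _; rewrite porbit_stable.
Qed.

Lemma face_class b : chain_class H (fun c => ((c \in porbit bn b) : nat)%:Z) = 0.
Proof.
rewrite -(shift_face H (face true b)) boundary_face /= [RHS]big_mkcond.
by apply: eq_bigr => c _; case: (_ \in _); rewrite ?mulr1z ?mulr0z.
Qed.

Lemma black_boundary_cycle a : is_cycle (black_boundary a).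
Proof.
apply: is_cycleB; last exact: strip_chain_cycle.
by apply: is_cycle_sum => b _; apply: face_cycle.
Qed.

Lemma black_boundary_class a : chain_class H (black_boundary a) = - strip_class H a.
Proof.
rewrite chain_classB strip_chain_class chain_class_sum big1 ?sub0r // => b _.
exact: face_class.
Qed.

Lemma black_boundary_supp a c : black_boundary a c != 0 ->
  exists b i, [/\ b \in porbit (zeta D) a, c = (bn ^+ i)%g b, (2 <= i)%N
                & (i < #|porbit bn b|)%N].
Proof.
have strE : strip_chain a c =
    \sum_(b in porbit (zeta D) a) (((b == c) : nat)%:Z + ((bn b == c) : nat)%:Z).
  rewrite big_split /= /strip_chain; congr (_ + _).
    rewrite -(indicator_sum (mem (porbit (zeta D) a)) c) (big_morph Posz PoszD (erefl _)).
    by apply: eq_bigr => b _; rewrite eq_sym.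
  rewrite -(indicator_sum (mem (porbit (zeta D) a)) ((bn^-1)%g c)) (big_morph Posz PoszD (erefl _)).
  by apply: eq_bigr => b _; rewrite (can2_eq (permK bn) (permKV bn)) eq_sym.
rewrite /black_boundary strE -sumrB => ne.
have [b] : exists b, b \in porbit (zeta D) a /\
   ((c \in porbit bn b) : nat)%:Z - (((b == c) : nat)%:Z + ((bn b == c) : nat)%:Z) != 0.
  apply: contrapT => none; case/negP: ne; apply/eqP; apply: big1 => b ba.
  by apply/eqP; apply: contrapT => /negP h; apply: none; exists b.
case=> ba nb; exists b.
have cb : c \in porbit bn b.
  apply: contraR nb => cb; rewrite (negPf cb).
  have /negPf -> : b != c by apply: contraNneq cb => <-; apply: porbit_id.
  have /negPf -> // : bn b != c.
  by apply: contraNneq cb => <-; rewrite porbit_stable porbit_id.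
have : c \in traject bn b #|porbit bn b| by rewrite -porbit_traject.
case/trajectP => i lt cE; exists i; rewrite permX; split=> //.
move: nb; rewrite cb cE; case: i lt cE => [|[|i]] //= lt cE.
  by rewrite eqxx; have /negPf /= -> := dimer_valence true b.
by rewrite eqxx; have := dimer_valence true b; rewrite eq_sym => /negPf /= ->.
Qed.

Lemma black_boundary_status a c : on_strip a -> black_boundary a c != 0 ->
  (tl c \in A) = (tl a \in A) /\ (hd c \in A) = (tl a \in A).
Proof.
move=> sa /black_boundary_supp[b [i [ba -> i2 lt]]].
have sb := sa _ ba.
have stb := strip_status sa ba.
have stz : (tl (zeta D b) \in A) = (tl a \in A).
  by rewrite (@strip_status a (zeta D b)) // porbit_stable.
have hdE : hd ((bn ^+ i)%g b) = tl ((bn ^+ i.+1)%g b) by rewrite expgSr permM.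
have w1 : tl a \in A -> tl ((bn ^+ i)%g b) \in A.
  by rewrite -stz -tl_exp2; apply: face_walk => //; apply: ltnW.
have w2 : tl ((bn ^+ i)%g b) \in A -> tl ((bn ^+ i.+1)%g b) \in A.
  exact: face_walk.
have w3 : tl ((bn ^+ i.+1)%g b) \in A -> tl a \in A.
  rewrite -stb -{2}[b](iter_porbit bn b) -permX; apply: face_walk => //.
  exact: leqW.
rewrite hdE; split; apply/idP/idP => //; first by move/w2.
by move/w1.
Qed.

(** The black boundary along [a1] shares its status in [A] and must meet the strip of [a2], because
    their classes pair nontrivially. *)
Lemma two_strips_status : (tl a1 \in A) = (tl a2 \in A).
Proof.
apply/esym; apply: (cycle_meets_strip sel2 (black_boundary_cycle a1)).
  rewrite black_boundary_class /toR raddfN.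
  by rewrite formNl oppr_eq0.
by move=> c; apply: black_boundary_status.
Qed.

(** The class of [w] is nonzero, so it pairs nontrivially with one of the two independent strip
    classes. *)
Lemma cycle_status w a0 (beta : bool) : is_cycle w -> (forall a, 0 <= w a) ->
  0 < w a0 -> (forall a, w a != 0 -> ~~ B v a) ->
  (forall c, w c != 0 -> (tl c \in A) = beta /\ (hd c \in A) = beta) ->
  (tl a1 \in A) = beta.
Proof.
move=> cw w0 wa0 wB wA.
have cl : toR R (chain_class H w) != 0.
  have := avoiding_cycle_class cw w0 wa0 wB; apply: contra => /eqP /rowP h.
  by apply/eqP/rowP => j; have := h j; rewrite !mxE => /eqP; rewrite intr_eq0 => /eqP.
have [h|h] := form_basis a12 cl; first exact: (cycle_meets_strip sel1 cw h wA).
by rewrite two_strips_status; apply: (cycle_meets_strip sel2 cw h wA).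
Qed.

(** A vertex outside [A] would yield one unmatched cycle inside [A] and another outside, giving
    [tl a1] two contradictory statuses. *)
Lemma forward_closed_full x0 : x0 \in A -> A = [set: Q0 D]%SET.
Proof.
move=> x0A; apply/setP => y; rewrite inE; apply: contraT => yA.
have /choice[s sP] x : exists a, tl a = x /\ ~~ B v a.
  by have [[a ta sa] _] := vertex_exit_entry x; exists a.
have /choice[t tP] x : exists a, hd a = x /\ ~~ B v a.
  by have [_ [a ta sa]] := vertex_exit_entry x; exists a.
have [|w [wc [aw aw0] wA]] := @recurrent_chain _ _ (@tl D) (@hd D) A s x0 _ x0A.
  by move=> x xA; have [tx sx] := sP x; split=> //; apply: A_fwd => //; rewrite tx.
(* Source and target are exchanged here: the complement of [A] is closed under following unmatched
   arrows backwards. *)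
have [||w' [w'c [aw' aw'0] w'A]] := @recurrent_chain _ _ (@hd D) (@tl D) (~: A)%SET t y.
- move=> x; rewrite inE => xA; have [tx sx] := tP x; split=> //.
  by rewrite inE; apply: contra xA => /(A_fwd sx); rewrite tx.
- by rewrite inE.
have natsum (u : arrow D -> nat) (P : pred (arrow D)) :
    \sum_(a | P a) (u a)%:Z = (\sum_(a | P a) u a)%N.
  by rewrite (big_morph Posz PoszD (erefl _)).
have in1 : (tl a1 \in A) = true.
  apply: (@cycle_status (fun a => (w a)%:Z) aw) => // [x|a|c].
  - by rewrite !natsum wc.
  - by rewrite eqz_nat => /wA[_ ->]; case: (sP (tl a)).
  rewrite eqz_nat => /wA[tc ->]; rewrite -/(s _); have [tx sx] := sP (tl c).
  by rewrite tx tc; split=> //; apply: A_fwd => //; rewrite tx.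
have in2 : (tl a1 \in A) = false; last by rewrite in1 in in2.
apply: (@cycle_status (fun a => (w' a)%:Z) aw') => // [x|a|c].
- by rewrite !natsum w'c.
- by rewrite eqz_nat => /w'A[_ ->]; case: (tP (hd a)).
rewrite eqz_nat => /w'A[]; rewrite inE => hc ->; have [tx sx] := tP (hd c).
by rewrite tx (negPf hc); split=> //; apply: contraNF hc => /(A_fwd sx); rewrite tx.
Qed.

End ForwardClosed.

(** The vertices reachable from [hd a] form a forward closed set, hence all of them; a walk back to
    [tl a] is closed up by [a]. *)
Lemma avoiding_cycle_through a : ~~ B v a ->
  exists w : arrow D -> nat,
    [/\ is_cycle (fun b => (w b)%:Z), (0 < w a)%N & forall b, w b != 0%N -> ~~ B v b].
Proof.
move=> na.
pose r x y := [exists b, [&& ~~ B v b, tl b == x & hd b == y]].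
pose A := [set x | connect r (hd a) x].
have full : A = [set: Q0 D]%SET.
  apply: (@forward_closed_full _ _ (hd a)); last by rewrite inE connect0.
  move=> b nb; rewrite !inE => h; apply: (connect_trans h); apply: connect1.
  by apply/existsP; exists b; rewrite nb !eqxx.
have : tl a \in A by rewrite full inE.
rewrite inE => /walk_chain[w [wb wB]].
exists (fun b => w b + (a == b))%N; split.
- move=> x; rewrite -!(big_morph Posz PoszD (erefl _)); congr Posz.
  by rewrite !big_split /= !indicator_sum /= wb.
- by rewrite eqxx addn1.
move=> b; rewrite addn_eq0 negb_and => /orP[/wB //|].
by rewrite eqb0 negbK => /eqP <-.
Qed.

Lemma supporting_cycle : exists w : arrow D -> int,
  [/\ is_cycle w, forall a, 0 <= w a & forall a, (w a == 0) = B v a].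
Proof.
have /choice[W WP] a : exists w : arrow D -> nat, ~~ B v a ->
    [/\ is_cycle (fun b => (w b)%:Z), (0 < w a)%N & forall b, w b != 0%N -> ~~ B v b].
  case: (boolP (B v a)) => [_|na]; first by exists (fun=> 0%N).
  by have [w wP] := avoiding_cycle_through na; exists w.
exists (fun b => \sum_(a | ~~ B v a) (W a b)%:Z); split.
- by apply: is_cycle_sum => a /WP[].
- by move=> a; apply: sumr_ge0.
move=> b; apply/idP/idP; last first.
  move=> Bb; apply/eqP; apply: big1 => a /WP[_ _ h]; apply/eqP; rewrite eqz_nat.
  by apply: contraT => /h; rewrite Bb.
apply: contraTT => nb; rewrite gt_eqF // (bigD1 b) //= ltr_wpDr ?sumr_ge0 //.
by have [_ h _] := WP b nb; rewrite ltz_nat.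
Qed.

End StrongConnectivity.

(** * Matchings with a supporting cycle *)

Section SupportingCycle.
Variables (D : dimer_model) (pi : {ffun arrow D -> int}) (w : arrow D -> int).
Hypothesis pi_pm : perfect_matching pi.
Hypothesis w_cycle : is_cycle w.
Hypothesis w_ge0 : forall a, 0 <= w a.
Hypothesis w_supp : forall a, (w a == 0) = (pi a != 0).

Lemma exact_pairing0 (V : zmodType) (g : Q0 D -> V) : \sum_a d0 g a *~ w a = 0.
Proof.
under eq_bigr => a _ do rewrite ffunE mulrzBl.
rewrite sumrB (partition_big (@hd D) predT) //= [X in _ - X](partition_big (@tl D) predT) //=.
rewrite -sumrB big1 // => x _; apply/eqP; rewrite subr_eq0; apply/eqP.
under eq_bigr => a /eqP -> do [].
under [RHS]eq_bigr => a /eqP -> do [].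
by rewrite -!mulrz_sumr w_cycle.
Qed.

(** On a black face [pi] has a single nonzero arrow, which must carry the whole degree of [q]
    there. *)
Lemma perfect_matching_sub_eq q : perfect_matching q ->
  (forall a, pi a = 0 -> q a = 0) -> q = pi.
Proof.
case=> q0 qf sub; apply/ffunP => a.
have [/eqP|pa] := boolP (pi a == 0); first by move=> h; rewrite h sub.
have [p0 /ffunP /(_ (face true a))] := pi_pm.
have af : a \in boundary (face true a) by rewrite boundary_face porbit_id.
have /ffunP /(_ (face true a)) := qf; rewrite !ffunE => qs ps.
have pa1 : 1 <= pi a by rewrite -gtz0_ge1 lt_neqAle eq_sym pa p0.
have rest b : b \in boundary (face true a) -> b != a -> pi b = 0.
  move=> bf ba; move: ps; rewrite (bigD1 a) //= (bigD1 b) /=; last by rewrite bf.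
  have r0 : 0 <= \sum_(i | (i \in boundary (face true a)) && (i != a) && (i != b)) pi i.
    exact: sumr_ge0.
  have := p0 b; move: r0 pa1; move: (\sum_(i | _) _) => S; lia.
move: ps qs; rewrite !(bigD1 a af) /= !big1 ?addr0 => [-> -> //|b|b].
  by case/andP => bf ba; rewrite sub // rest.
by case/andP => bf ba; rewrite rest.
Qed.

Lemma matching_of_pairing0 q : perfect_matching q -> \sum_a q a *~ w a = 0 -> q = pi.
Proof.
move=> qpm q0; apply: perfect_matching_sub_eq => // a pa.
have : q a *~ w a = 0.
  have : \sum_a q a *~ w a == 0 by rewrite q0.
  rewrite psumr_eq0 => [/allP /(_ a)|b _]; first by rewrite mem_index_enum => /(_ isT) /eqP.
  by rewrite -mulrzr intz mulr_ge0 //; case: qpm.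
rewrite -mulrzr intz => /eqP; rewrite mulf_eq0 w_supp pa eqxx orbF.
by move/eqP.
Qed.

Lemma pairing_self0 (V : zmodType) (f : int -> V) : f 0 = 0 ->
  \sum_a f (pi a) *~ w a = 0.
Proof.
move=> f0; apply: big1 => a _.
have [->|] := eqVneq (pi a) 0; first by rewrite f0 mul0rz.
by rewrite -w_supp => /eqP ->; rewrite mulr0z.
Qed.

Lemma supported_multiplicity_one : has_multiplicity (No_class pi) 1.
Proof.
rewrite /has_multiplicity.
have -> : [set q | perfect_matching q /\ No_class q = No_class pi]%classic = [set pi]%classic.
  apply/seteqP; split=> [q /= [qpm E]|q /= ->]; last by [].
  have : No_class pi q.
    rewrite -E; exists (fun=> 0); apply/ffunP => a.
    by rewrite !ffunE /= subrr addr0.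
  case=> g qE; apply: matching_of_pairing0 => //.
  rewrite qE; under eq_bigr => a _ do rewrite ffunE mulrzDl.
  by rewrite big_split /= exact_pairing0 addr0 (pairing_self0 (f := id)).
exact: card_set1.
Qed.

Variable R : realType.

Lemma NoR_pairing (u u' : {ffun arrow D -> R}) : NoR_class u = NoR_class u' ->
  \sum_a u a *~ w a = \sum_a u' a *~ w a.
Proof.
move=> E; have : NoR_class u' u.
  rewrite -E; exists (fun=> 0); apply/ffunP => a.
  by rewrite !ffunE /= subrr addr0.
case=> g ->; under eq_bigr => a _ do rewrite ffunE mulrzDl.
by rewrite big_split /= exact_pairing0 addr0.
Qed.

(** Pairing with [w] is a supporting functional of the polygon: a convex combination pairs to zero
    only if every matching of positive weight is [pi]. *)
Lemma polygon_pairing (u : {ffun arrow D -> R}) : degree_one_polygon (NoR_class u) ->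
  0 <= \sum_a u a *~ w a /\
  (\sum_a u a *~ w a = 0 -> NoR_class u = NoR_class (cochainR R pi)).
Proof.
case=> n [s [p [s0 s1 ppm uE]]]; rewrite (NoR_pairing uE) uE.
have pw i : 0 <= \sum_a cochainR R (p i) a *~ w a.
  apply: sumr_ge0 => a _; rewrite ffunE -mulrzr mulr_ge0 ?ler0z //.
  by case: (ppm i).
have E : \sum_a [ffun a => \sum_i s i * cochainR R (p i) a] a *~ w a =
         \sum_i s i * \sum_a cochainR R (p i) a *~ w a.
  under eq_bigr => a _ do rewrite ffunE mulrz_suml.
  rewrite exchange_big; apply: eq_bigr => i _; rewrite mulr_sumr.
  by apply: eq_bigr => a _; rewrite -mulrzAr.
rewrite E; split; first by apply: sumr_ge0 => i _; rewrite mulr_ge0.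
move/eqP; rewrite psumr_eq0 => [/allP h|i _]; last by rewrite mulr_ge0.
congr (NoR_class _); apply/ffunP => a; rewrite !ffunE.
rewrite -[RHS]mul1r -[X in _ = X * _]s1 mulr_suml; apply: eq_bigr => i _.
have := h i; rewrite mem_index_enum => /(_ isT); rewrite mulf_eq0.
case/orP => [/eqP ->|/eqP z]; first by rewrite !mul0r.
suff -> : p i = pi by rewrite ?ffunE.
apply: matching_of_pairing0 => //; apply/eqP; rewrite -(intr_eq0 R) -z.
apply/eqP; rewrite rmorph_sum; apply: eq_bigr => b _.
by rewrite rmorphMz ffunE.
Qed.

Lemma supported_extremal : extremal R pi.
Proof.
split.
  exists 1%N, (fun=> 1), (fun=> pi); split=> //; first by rewrite big_ord1.
  by congr (NoR_class _); apply/ffunP => a; rewrite !ffunE big_ord1 mul1r ?ffunE.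
move=> u u' t /andP[t0 t1] /polygon_pairing[u0 uE] /polygon_pairing[u'0 u'E] E.
have := NoR_pairing E.
have -> : \sum_a cochainR R pi a *~ w a = 0.
  under eq_bigr => a _ do rewrite ffunE.
  exact: (pairing_self0 (f := fun k : int => k%:~R)).
have -> : \sum_a [ffun a => t * u a + (1 - t) * u' a] a *~ w a =
   t * (\sum_a u a *~ w a) + (1 - t) * (\sum_a u' a *~ w a).
  rewrite !mulr_sumr -big_split /=; apply: eq_bigr => a _.
  by rewrite ffunE mulrzDl !mulrzAr.
move=> /esym/eqP; have t1' : 0 < 1 - t by rewrite subr_gt0.
rewrite paddr_eq0 ?mulr_ge0 ?(ltW t0) ?(ltW t1') //.
rewrite !mulf_eq0 (gt_eqF t0) (gt_eqF t1') /= => /andP[/eqP h /eqP h'].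
by rewrite (uE h) (u'E h').
Qed.

End SupportingCycle.

(** * Geometry of the rhombic embedding *)

(** The circles centred at p and q through the origin meet again only at p + q: both d and p + q are
    orthogonal to p - q, and d has the same inner product with p + q as with itself. *)
Lemma rhombus_diagonal (R : realFieldType) (p0 p1 q0 q1 d0 d1 : R) :
  p0 ^+ 2 + p1 ^+ 2 = q0 ^+ 2 + q1 ^+ 2 ->
  2 * (p0 * d0 + p1 * d1) = d0 ^+ 2 + d1 ^+ 2 ->
  2 * (q0 * d0 + q1 * d1) = d0 ^+ 2 + d1 ^+ 2 ->
  d0 ^+ 2 + d1 ^+ 2 != 0 -> p0 * q1 - p1 * q0 != 0 ->
  d0 = p0 + q0 /\ d1 = p1 + q1.
Proof.
move=> E1 E2 E3 dn pq.
pose s0 := p0 + q0; pose s1 := p1 + q1.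
have ed : (p0 - q0) * d0 + (p1 - q1) * d1 = 0 by lra.
have es : (p0 - q0) * s0 + (p1 - q1) * s1 = 0 by rewrite /s0 /s1; lra.
have det0 : d0 * s1 - d1 * s0 = 0.
  have h0 : (p0 - q0) * (d0 * s1 - d1 * s0) = 0.
    rewrite -[RHS](subr0 0) -{1}(mul0r s1) -{1}ed -(mul0r d1) -es; ring.
  have h1 : (p1 - q1) * (d0 * s1 - d1 * s0) = 0.
    rewrite -[RHS](subr0 0) -{1}(mul0r d0) -{1}es -(mul0r s0) -ed; ring.
  move/eqP: h0; rewrite mulf_eq0 => /orP[|/eqP //] /eqP e0.
  move/eqP: h1; rewrite mulf_eq0 => /orP[|/eqP //] /eqP e1.
  case/negP: pq; apply/eqP.
  by rewrite (subr0_eq e0) (subr0_eq e1); ring.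
have ds : d0 * s0 + d1 * s1 = d0 ^+ 2 + d1 ^+ 2 by rewrite /s0 /s1; lra.
have ns : s0 ^+ 2 + s1 ^+ 2 = d0 ^+ 2 + d1 ^+ 2.
  apply: (mulfI dn).
  have -> : (d0 ^+ 2 + d1 ^+ 2) * (s0 ^+ 2 + s1 ^+ 2) =
    (d0 * s0 + d1 * s1) ^+ 2 + (d0 * s1 - d1 * s0) ^+ 2 by ring.
  by rewrite ds det0 expr0n addr0.
have : (d0 - s0) ^+ 2 + (d1 - s1) ^+ 2 = 0.
  have -> : (d0 - s0) ^+ 2 + (d1 - s1) ^+ 2 =
    (d0 ^+ 2 + d1 ^+ 2) - 2 * (d0 * s0 + d1 * s1) + (s0 ^+ 2 + s1 ^+ 2) by ring.
  by rewrite ds ns; ring.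
move/eqP; rewrite paddr_eq0 ?sqr_ge0 // !sqrf_eq0 !subr_eq0.
by case/andP => /eqP -> /eqP ->.
Qed.

Section LiftedFaces.
Variables (D : dimer_model) (H : homology_marking D).

Lemma iter_lnext c k (x : larrow D) :
  iter k (lnext H c) x = ((next D c ^+ k)%g x.1,
    x.2 + \sum_(i < k) shift H ((next D c ^+ i)%g x.1)).
Proof.
elim: k => [|k IH]; first by rewrite /= perm1 big_ord0 addr0; case: x.
by rewrite iterS IH /lnext /= expgSr permM big_ord_recr /= addrA.
Qed.

(** Since [shift] sums to zero around a face, the lifted walk closes up in the same sheet. *)
Lemma lnext_loop c (x : larrow D) :
  iter #|porbit (next D c) x.1| (lnext H c) x = x.
Proof.
rewrite iter_lnext -sum_porbit -boundary_face shift_face addr0.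
by rewrite permX iter_porbit; case: x.
Qed.

Lemma lface_lnext c (x : larrow D) : lface H c (lnext H c x) = lface H c x.
Proof.
apply/seteqP; split=> y [k ->].
  by exists k.+1; rewrite -iterSr.
case: k => [|k]; last by exists k; rewrite -iterSr.
exists #|porbit (next D c) x.1|.-1; rewrite -iterSr prednK; last first.
  by rewrite lt0n card_porbit_neq0.
by rewrite lnext_loop.
Qed.

Lemma lhead_lnext c (x : larrow D) : lhead H x = ltail (lnext H c x).
Proof. by rewrite /lhead /ltail (hd_next c). Qed.

Lemma lnext_inj c : injective (lnext H c).
Proof. by case=> a m [b n] [] /perm_inj -> /addIr ->. Qed.

Definition ltranslate (m : 'rV[int]_2) (x : larrow D) : larrow D := (x.1, x.2 + m).

Lemma lnext_translate c m x :
  lnext H c (ltranslate m x) = ltranslate m (lnext H c x).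
Proof. by rewrite /lnext /ltranslate /= addrAC. Qed.

End LiftedFaces.

Section RhombicEmbedding.
Variables (R : realType) (D : dimer_model) (H : homology_marking D).
Variables (L : 'M[R]_2) (posV : lvertex D -> 'rV[R]_2).
Variable posF : bool -> set (larrow D) -> 'rV[R]_2.
Hypothesis emb : rhombic_embedding H posV posF L.
Local Notation bn := (bnext D).
Local Notation wn := (wnext D).

Definition corner c (a : arrow D) : 'rV[R]_2 :=
  posF c (lface H c (a, 0)) - posV (tl a, 0).

Lemma corner_lift c x : posF c (lface H c x) = posV (ltail x) + corner c x.1.
Proof.
case: emb => _ [eV eF] _ _ _; case: x => a m; rewrite /ltail /corner /=.
rewrite -[m in lface _ _ (a, m)]add0r eF -[m in posV (_, m)]add0r eV.
by rewrite [RHS]addrC addrA addrNK.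
Qed.

Lemma quad_inj c x x' : posF c (lface H c x) = posF c (lface H c x') ->
  posV (ltail x) = posV (ltail x') -> x = x'.
Proof.
move=> EF EV; case: emb => _ _ inj _ _.
(* At the midpoint of an edge, injectivity leaves only the alternative that the edges coincide. *)
have half : 0 <= (2^-1 : R) <= 1 by rewrite invr_ge0 ler0n invf_le1 ?ler1n.
have [|_ []] := inj c x 2^-1 c x' 2^-1 half half.
- by rewrite /quad_point EF EV.
- by case=> /eqP; rewrite invr_eq0 pnatr_eq0.
- by case=> /eqP; rewrite invr_eq1 (eqr_nat R 2 1).
by case.
Qed.

(** Injectivity of the embedding prevents a lifted face from having two corners at the same
    vertex. *)
Lemma flow_next c x y : lhead H x = ltail y -> lface H c x = lface H c y ->
  y = lnext H c x.
Proof.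
move=> Et Ef; apply: (@quad_inj c); first by rewrite lface_lnext Ef.
by rewrite -Et (lhead_lnext H c).
Qed.

Lemma corner_head c x : posV (lhead H x) = posV (ltail x) + corner c x.1
  - corner c (next D c x.1).
Proof.
rewrite -corner_lift -(lface_lnext H c x) corner_lift.
by rewrite -(lhead_lnext H c) /= addrK.
Qed.

Lemma corner_enorm c c' a a' :
  corner c a 0 0 ^+ 2 + corner c a 0 1 ^+ 2 =
  corner c' a' 0 0 ^+ 2 + corner c' a' 0 1 ^+ 2.
Proof.
have nn (u : 'rV[R]_2) : 0 <= u 0 0 ^+ 2 + u 0 1 ^+ 2 by rewrite addr_ge0 ?sqr_ge0.
case: emb => _ _ _ _ [r rE]; rewrite -(sqr_sqrtr (nn _)) -[RHS](sqr_sqrtr (nn _)).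
by congr (_ ^+ 2); rewrite -!/(enorm _) (rE c (a, 0)) (rE c' (a', 0)).
Qed.

Lemma corner_oriented a : 0 < det2 (corner false a) (corner true a).
Proof. by case: emb => _ _ _ or _; apply: (or (a, 0)). Qed.

(** The head of [a] is reached through both faces, so [d] is a common diagonal. It is nonzero, as
    otherwise [wn] would fix [a]; [rhombus_diagonal] then makes opposite sides parallel. *)
Lemma corner_opposite a :
  corner false (wn a) = - corner true a /\ corner true (bn a) = - corner false a.
Proof.
have hw := corner_head false (a, 0); have hb := corner_head true (a, 0).
have E : corner false a - corner false (wn a) = corner true a - corner true (bn a).
  apply: (addrI (posV (ltail ((a, 0) : larrow D)))); rewrite addrA [RHS]addrA.
  exact: etrans (esym hw) hb.
pose d := corner false a - corner false (wn a).
have dn : d 0 0 ^+ 2 + d 0 1 ^+ 2 != 0.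
  apply/eqP => /eqP; rewrite paddr_eq0 ?sqr_ge0 // !sqrf_eq0 => /andP[/eqP d0 /eqP d1].
  have d00 : d = 0.
    by apply: row2P; rewrite ?d0 ?d1 [RHS]mxE.
  have : lnext H false (a, 0) = (a, 0) :> larrow D.
    apply: (@quad_inj false); rewrite ?lface_lnext //.
    rewrite -lhead_lnext hw -[RHS]addr0 -d00; apply: esym; exact: addrA.
  by case=> /eqP; rewrite (negPf (dimer_valence false a)).
have N1 := corner_enorm false true a a.
have N2 := corner_enorm false false a (wn a).
have N3 := corner_enorm true true a (bn a).
have o := lt0r_neq0 (corner_oriented a).
have wE : corner false (wn a) = corner false a - d by rewrite /d opprB addrC addrNK.
have bE : corner true (bn a) = corner true a - d by rewrite /d E opprB addrC addrNK.
have [||d0 d1] := rhombus_diagonal N1 _ _ dn o.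
- by move: N2; rewrite wE !mxE; lra.
- by move: N3; rewrite bE !mxE; lra.
rewrite wE bE; move: d0 d1; clearbody d.
move: (corner false a) (corner true a) => p q d0 d1.
by split; apply: row2P; rewrite !mxE; lra.
Qed.

Lemma corner_zeta a : corner false (wn (bn a)) = corner false a.
Proof.
by have [-> _] := corner_opposite (bn a); have [_ ->] := corner_opposite a; rewrite opprK.
Qed.

Lemma corner_back a : corner true a = - corner false ((bn^-1)%g a).
Proof. by have [_] := corner_opposite ((bn^-1)%g a); rewrite permKV. Qed.

Lemma corner_pos a : 0 < det2 (corner false ((bn^-1)%g a)) (corner false a).
Proof.
have := corner_oriented a; rewrite corner_back /det2 !mxE; lra.
Qed.

End RhombicEmbedding.

(** * Zig-zag flows *)

Lemma int_parity (n : int) : exists q : int, n = 2 * q \/ n = 2 * q + 1.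
Proof.
exists (n %/ 2)%Z; have := divz_eq n 2; have := ltz_pmod n (isT : (0 : int) < 2).
have := modz_ge0 n (isT : (2 : int) != 0).
move: (n %% 2)%Z (n %/ 2)%Z => r k; lia.
Qed.

Lemma sum_double (V : nmodType) (F : nat -> V) K :
  \sum_(i < K.*2) F i = \sum_(i < K) (F i.*2 + F i.*2.+1).
Proof.
elim: K => [|K IH]; first by rewrite !big_ord0.
by rewrite doubleS !big_ord_recr /= IH addrA.
Qed.

Section ZigZagExistence.
Variables (D : dimer_model) (H : homology_marking D).

Definition zlift (x : larrow D) : larrow D := lnext H false (lnext H true x).

Definition lprev c (x : larrow D) : larrow D :=
  (((next D c)^-1)%g x.1, x.2 - shift H (((next D c)^-1)%g x.1)).

Lemma lprevK c : cancel (lprev c) (lnext H c).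
Proof. by case=> a m; rewrite /lnext /lprev /= permKV subrK. Qed.

Definition zliftV (x : larrow D) : larrow D := lprev true (lprev false x).

Lemma zliftVK : cancel zliftV zlift.
Proof. by move=> x; rewrite /zlift /zliftV !lprevK. Qed.

Definition zig (x : larrow D) (q : int) : larrow D :=
  match q with Posz k => iter k zlift x | Negz k => iter k.+1 zliftV x end.

Lemma zigS x q : zig x (q + 1) = zlift (zig x q).
Proof.
case: q => [k|[|k]]; first by rewrite -PoszD addn1.
  by rewrite /= zliftVK.
have -> : Negz k.+1 + 1 = Negz k by lia.
by rewrite /= zliftVK.
Qed.

Definition zigzag_of (x : larrow D) (n : int) : larrow D :=
  if (2 %| n)%Z then zig x (n %/ 2)%Z else lnext H true (zig x (n %/ 2)%Z).

Lemma zigzag_of_even x q : zigzag_of x (2 * q) = zig x q.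
Proof. by rewrite /zigzag_of dvdz_mulr // mulKz. Qed.

Lemma zigzag_of_odd x q : zigzag_of x (2 * q + 1) = lnext H true (zig x q).
Proof.
rewrite /zigzag_of (_ : (2 %| 2 * q + 1)%Z = false); last by lia.
by rewrite (_ : ((2 * q + 1) %/ 2)%Z = q) //; lia.
Qed.

Lemma zigzag_of_flow x : zigzag_flow H (zigzag_of x).
Proof.
move=> n; split.
- have [q [->|->]] := int_parity n.
    by rewrite zigzag_of_odd zigzag_of_even (lhead_lnext H true).
  rewrite zigzag_of_odd -addrA (_ : 2 * q + (1 + 1) = 2 * (q + 1)); last by lia.
  by rewrite zigzag_of_even zigS (lhead_lnext H false).
- by rewrite zigzag_of_odd zigzag_of_even lface_lnext.
have -> : 2 * n - 1 = 2 * (n - 1) + 1 by lia.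
rewrite zigzag_of_odd zigzag_of_even.
by rewrite -{2}(subrK 1 n) zigS lface_lnext.
Qed.

Lemma zigzag_of0 x : zigzag_of x 0 = x.
Proof. by have := zigzag_of_even x 0; rewrite mulr0. Qed.

Lemma zigzag_of1 x : zigzag_of x 1 = lnext H true x.
Proof. by have := zigzag_of_odd x 0; rewrite mulr0. Qed.

End ZigZagExistence.

Section Flows.
Variables (R : realType) (D : dimer_model) (H : homology_marking D).
Variables (L : 'M[R]_2) (posV : lvertex D -> 'rV[R]_2).
Variable posF : bool -> set (larrow D) -> 'rV[R]_2.
Hypothesis emb : rhombic_embedding H posV posF L.
Local Notation bn := (bnext D).
Local Notation wn := (wnext D).
Variable eta : int -> larrow D.
Hypothesis flow : zigzag_flow H eta.

Lemma flow_odd q : eta (2 * q + 1) = lnext H true (eta (2 * q)).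
Proof. by have [h _ _] := flow (2 * q); have [_ f _] := flow q; apply: (flow_next emb). Qed.

Lemma flow_even q : eta (2 * (q + 1)) = zlift H (eta (2 * q)).
Proof.
rewrite /zlift -flow_odd; apply: (flow_next emb).
  by have [-> _ _] := flow (2 * q + 1); congr (ltail (eta _)); lia.
have [_ _] := flow (q + 1); rewrite (_ : 2 * (q + 1) - 1 = 2 * q + 1) //; lia.
Qed.

Lemma flow_iter q (k : nat) : (eta (2 * (q + k%:Z))).1 = (zeta D ^+ k)%g (eta (2 * q)).1.
Proof.
elim: k => [|k IH]; first by rewrite addr0 perm1.
rewrite (_ : q + k.+1%:Z = q + k%:Z + 1); last by lia.
by rewrite flow_even /= IH expgSr permM zetaE.
Qed.

Lemma flow_orbit q : (eta (2 * q)).1 \in porbit (zeta D) (eta 0).1.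
Proof.
have [q0|q0] := leP 0 q.
  have := flow_iter 0 `|q|%N; rewrite add0r mulr0 gez0_abs // => ->.
  exact: mem_porbit.
have := flow_iter q `|q|%N; rewrite ltz0_abs // subrr mulr0 => ->.
by rewrite porbit_sym mem_porbit.
Qed.

Let a := (eta 0).1.
Let K := #|porbit (zeta D) a|.

Lemma flow_period : is_period eta K.*2.
Proof.
split; first by rewrite double_gt0 lt0n card_porbit_neq0.
have per q : (eta (2 * (q + K%:Z))).1 = (eta (2 * q)).1.
  rewrite flow_iter permX /K.
  have /eqP <- : porbit (zeta D) (eta (2 * q)).1 == porbit (zeta D) a.
    by rewrite eq_porbit_mem flow_orbit.
  by rewrite iter_porbit.
move=> n; have [q [->|->]] := int_parity n.
  by rewrite -per; congr (eta _).1; lia.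
have -> : 2 * q + 1 + K.*2%:Z = 2 * (q + K%:Z) + 1 by lia.
by rewrite !flow_odd /= per.
Qed.

Lemma flow_period_ge p : is_period eta p -> (K.*2 <= p)%N.
Proof.
case=> p0 per; have /= := per 0; rewrite add0r -/a => pa.
have [q qE] := int_parity p%:Z; have [k kE] : exists k : nat, q = k%:Z.
  by exists `|q|%N; lia.
move: qE; rewrite kE => -[pE|pE].
  have := flow_iter 0 k; rewrite add0r mulr0 -pE pa -/a => /esym/eqP.
  rewrite porbit_expE -/K => /dvdn_leq; move: p0; lia.
(* An odd period would put [a] and its black predecessor in one [zeta] orbit, giving them the same
   transverse vector. *)
have := corner_pos emb a; move: pa; rewrite pE flow_odd /= => aE.
have : (bn^-1)%g a \in porbit (zeta D) a by rewrite -{1}aE permK flow_orbit.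
move/(W_porbit (corner_zeta emb)) => ->.
by rewrite /det2 mulrC subrr ltxx.
Qed.

Lemma flow_class_strip : flow_class H eta (strip_class H a).
Proof.
exists K.*2; split; [exact: flow_period|exact: flow_period_ge|].
rewrite (sum_double (fun i => shift H (eta i%:Z).1)) /strip_class sum_porbit.
apply: eq_bigr => i _.
have -> : i.*2%:Z = 2 * i%:Z by lia.
have -> : i.*2.+1%:Z = 2 * i%:Z + 1 by lia.
by rewrite flow_odd /=; have := flow_iter 0 i; rewrite add0r mulr0 => ->.
Qed.

Lemma flow_class_unique m : flow_class H eta m -> m = strip_class H a.
Proof.
have [q [q1 q2 ->]] := flow_class_strip; case=> p [p1 p2 ->].
by have -> : p = q by apply/eqP; rewrite eqn_leq p2 // q2.
Qed.

Lemma flow_class_at n m : flow_class H eta m ->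
  m = strip_class H (eta n).1 \/ m = strip_class H ((bn^-1)%g (eta n).1).
Proof.
have strE b : b \in porbit (zeta D) a -> strip_class H b = strip_class H a.
  by rewrite /strip_class -eq_porbit_mem => /eqP ->.
move/flow_class_unique ->; have [q [->|->]] := int_parity n.
  by left; rewrite strE ?flow_orbit.
by right; rewrite flow_odd /= permK strE ?flow_orbit.
Qed.

End Flows.

(** * Primitivity of zig-zag classes *)

Section PiecewiseLinear.
Variables (R : realType) (l s : nat -> R).
Hypothesis l_lt : forall i, l i < l i.+1.

Definition edge_slope i : R := (s i.+1 - s i) / (l i.+1 - l i).

(** Written as a sum of clamped increments, so that continuity is immediate and the value is
    constant outside the range of the nodes. *)
Fixpoint interpolation n (x : R) : R :=
  if n is i.+1 then
    interpolation i x +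
      edge_slope i * Num.min (Num.max (x - l i) 0) (l i.+1 - l i)
  else s 0.

Lemma interpolationS n x : interpolation n.+1 x = interpolation n x +
  edge_slope n * Num.min (Num.max (x - l n) 0) (l n.+1 - l n).
Proof. by []. Qed.

Lemma interpolation_continuous n : continuous (interpolation n : R -> R).
Proof.
elim: n => [|n IH] x; first exact: cst_continuous.
apply: cvgD; first exact: IH.
apply: cvgM; first exact: cvg_cst.
apply: (continuous_min (f := fun x => Num.max (x - l n) 0)); last exact: cvg_cst.
apply: (continuous_max (f := fun x => x - l n)); last exact: cvg_cst.
by apply: cvgB; [exact: cvg_id|exact: cvg_cst].
Qed.

Lemma l_mono i j : (i <= j)%N -> l i <= l j.
Proof.
move/subnKC <-; elim: (j - i)%N => [|k IH]; first by rewrite addn0.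
by rewrite addnS (le_trans IH) // ltW.
Qed.

Lemma edge_slopeE i : edge_slope i * (l i.+1 - l i) = s i.+1 - s i.
Proof. by rewrite divfK // subr_eq0 gt_eqF. Qed.

Lemma interpolation_end n x : l n <= x -> interpolation n x = s n.
Proof.
elim: n => [//|n IH] nx /=; rewrite IH; last exact: le_trans (ltW (l_lt n)) nx.
rewrite max_l ?min_r ?lerB // ?edge_slopeE ?subrKC // subr_ge0.
exact: le_trans (ltW (l_lt n)) nx.
Qed.

Lemma interpolation_edge n j x : (j < n)%N -> l j <= x -> x <= l j.+1 ->
  interpolation n x = s j + edge_slope j * (x - l j).
Proof.
move=> jn jx xj; rewrite -(subnKC jn); elim: (n - j.+1)%N => [|k IH].
  rewrite addn0 /= interpolation_end // max_l ?subr_ge0 // min_l //.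
  by rewrite lerB.
rewrite addnS interpolationS IH max_r ?min_l ?mulr0 ?addr0 //.
  by rewrite subr_ge0 ltW.
by rewrite subr_le0 (le_trans xj) // l_mono // leq_addr.
Qed.

Lemma locate_edge n x : l 0 <= x -> x <= l n -> (0 < n)%N ->
  exists j, [/\ (j < n)%N, l j <= x & x <= l j.+1].
Proof.
move=> x0; case: n => // n xn _; elim: n xn => [|n IH] xn; first by exists 0%N.
have [/IH[j [jn h1 h2]]|nx] := leP x (l n.+1).
  by exists j; split=> //; apply: leqW.
by exists n.+1; split=> //; apply: ltW.
Qed.

Lemma interpolation_point n x : l 0 <= x -> x <= l n -> (0 < n)%N ->
  exists j t, [/\ 0 <= t <= 1, x = (1 - t) * l j + t * l j.+1
                & interpolation n x = (1 - t) * s j + t * s j.+1].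
Proof.
move=> x0 xn n0; have [j [jn h1 h2]] := locate_edge x0 xn n0.
have dj : 0 < l j.+1 - l j by rewrite subr_gt0.
exists j, ((x - l j) / (l j.+1 - l j)); split.
- by rewrite divr_ge0 ?subr_ge0 ?(ltW (l_lt j)) //= ler_pdivrMr // mul1r lerB.
- by field; rewrite gt_eqF.
by rewrite (interpolation_edge jn h1 h2) /edge_slope; field; rewrite gt_eqF.
Qed.

(* The graph over the l-axis has drift (k alpha, k gamma) over a period, so   *)
(* its vertical distance to the translate by (alpha, gamma) sums to zero over *)
(* k equally spaced points and vanishes somewhere.                            *)
Lemma periodic_graph_meets_translate (P k : nat) (alpha gamma : R) :
  (0 < P)%N -> (0 < k)%N ->
  (forall i, l (i + P)%N = l i + k%:R * alpha) ->
  s P = s 0%N + k%:R * gamma ->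
  exists i j t t', [/\ 0 <= t <= 1, 0 <= t' <= 1,
    (1 - t) * l i + t * l i.+1 = (1 - t') * l j + t' * l j.+1 + alpha
    & (1 - t) * s i + t * s i.+1 = (1 - t') * s j + t' * s j.+1 + gamma].
Proof.
(* Two periods of nodes, so that [x + alpha] is still covered when [x] runs over the first
   period. *)
move=> P0 k0 lP sP; pose f := interpolation (P + P).
have k0' : 0 < k%:R :> R by rewrite ltr0n.
have lP0 : l P = l 0%N + k%:R * alpha by rewrite -(lP 0%N).
have lPP : l (P + P)%N = l 0%N + k%:R * alpha + k%:R * alpha by rewrite lP lP0.
have P0' : l 0%N < l P by rewrite (lt_le_trans (l_lt 0)) // l_mono.
have a0 : 0 < alpha by move: P0'; rewrite lP0 ltrDl pmulr_rgt0.
pose d x := f x + gamma - f (x + alpha).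
have dsum : \sum_(j < k) d (l 0%N + j%:R * alpha) = 0.
  have -> : \sum_(j < k) d (l 0%N + j%:R * alpha) =
     f (l 0%N) + k%:R * gamma - f (l 0%N + k%:R * alpha).
    elim: (k) => [|n IH]; first by rewrite big_ord0 !mul0r !addr0 subrr.
    by rewrite big_ord_recr /= IH /d -natr1 !mulrDl !mul1r !addrA; ring.
  have fl j : (j < P + P)%N -> f (l j) = s j.
    by move=> jP; rewrite /f (interpolation_edge jP) ?subrr ?mulr0 ?addr0 // ltW.
  rewrite -lP0 !fl ?addn_gt0 ?P0 //; last by rewrite -[X in (X < _)%N]addn0 ltn_add2l.
  by rewrite sP; ring.
pose p (i : 'I_k) := l 0%N + i%:R * alpha.
have pbd i : l 0%N <= p i <= l P.
  rewrite lerDl mulr_ge0 ?ler0n ?(ltW a0) //= lP0 lerD2l ler_pM2r // ler_nat.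
  exact: ltnW.
(* Terms with zero sum cannot all be strictly of one sign; [c] will be 1 and -1. *)
have sgn (c : R) : exists i, 0 <= c * d (p i).
  apply: contrapT => none.
  have neg i : 0 <= - (c * d (p i)).
    by rewrite oppr_ge0 leNgt; apply/negP => /ltW h; apply: none; exists i.
  have : \sum_i - (c * d (p i)) == 0 by rewrite sumrN -mulr_sumr dsum mulr0 oppr0.
  rewrite psumr_eq0 // => /allP /(_ (Ordinal k0)); rewrite mem_index_enum => /(_ isT).
  by rewrite oppr_eq0 => /eqP h; apply: none; exists (Ordinal k0); rewrite h.
have dc : continuous d.
  move=> x; apply: cvgB; first by apply: cvgD; [exact: interpolation_continuous|exact: cvg_cst].
  apply: (@continuous_comp _ _ _ (fun x => x + alpha) f).
    by apply: cvgD; [exact: cvg_id|exact: cvg_cst].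
  exact: interpolation_continuous.
have ivt u v : u <= v -> Num.min (d u) (d v) <= 0 <= Num.max (d u) (d v) ->
    l 0%N <= u -> v <= l P -> exists2 y, l 0%N <= y <= l P & d y = 0.
  move=> uv m lu vl.
  have [y] := IVT uv (continuous_subspaceT dc) m.
  rewrite in_itv /= => /andP[h1 h2] dy; exists y => //.
  by rewrite (le_trans lu h1) (le_trans h2 vl).
have [y yP y0] : exists2 y, l 0%N <= y <= l P & d y = 0.
  have [i] := sgn 1; have [j] := sgn (- 1).
  rewrite mulN1r mul1r oppr_ge0 => dj di.
  have /andP[i1 i2] := pbd i; have /andP[j1 j2] := pbd j.
  have [ij|ji] := leP (p i) (p j).
    by apply: (ivt _ _ ij) => //; rewrite ge_min dj orbT le_max di.
  by apply: (ivt _ _ (ltW ji)) => //; rewrite ge_min dj le_max di orbT.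
case/andP: yP => y1 y2; have aP : alpha <= k%:R * alpha.
  by rewrite ler_peMl ?(ltW a0) // ler1n.
have [|||i [t [t01 iE fi]]] := @interpolation_point (P + P) (y + alpha).
- by rewrite (le_trans y1) // lerDl (ltW a0).
- by rewrite lPP lerD // -lP0.
- by rewrite addn_gt0 P0.
have [||j [t' [t'01 jE fj]]] := @interpolation_point (P + P) y y1.
- by rewrite (le_trans y2) // l_mono // leq_addr.
- by rewrite addn_gt0 P0.
exists i, j, t, t'; split=> //; first by rewrite -iE -jE.
by rewrite -fi -fj; apply/esym/eqP; rewrite -subr_eq0; apply/eqP.
Qed.

End PiecewiseLinear.

Section Primitivity.
Variables (R : realType) (D : dimer_model) (H : homology_marking D).
Variables (L : 'M[R]_2) (posV : lvertex D -> 'rV[R]_2).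
Variable posF : bool -> set (larrow D) -> 'rV[R]_2.
Hypothesis emb : rhombic_embedding H posV posF L.
Local Notation bn := (bnext D).
Local Notation wn := (wnext D).
Local Notation corner := (corner H posV posF).
Variable a : arrow D.

Let u : 'rV[R]_2 := corner false a.
Let x n : larrow D := iter n (zlift H) (a, 0).
Let m := strip_class H a.
Let K := #|porbit (zeta D) a|.
(** One side of the strip of rhombi, a broken line alternating between tails of even arrows and
    black dimer vertices. *)
Let pt i : 'rV[R]_2 :=
  if odd i then posF true (lface H true (x i./2)) else posV (ltail (x i./2)).
Let dot (v w : 'rV[R]_2) : R := v 0 0 * w 0 0 + v 0 1 * w 0 1.

Lemma zlift_iter n : x n = ((zeta D ^+ n)%g a,
  \sum_(i < n) (shift H ((zeta D ^+ i)%g a) + shift H (bn ((zeta D ^+ i)%g a)))).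
Proof.
elim: n => [|n IH]; first by rewrite /x /= perm1 big_ord0.
rewrite /x iterS -/(x n) IH /zlift /lnext /=; congr (_, _).
  by rewrite expgSr permM zetaE.
by rewrite big_ord_recr /= addrA.
Qed.

Lemma zlift_translate k y : zlift H (ltranslate k y) = ltranslate k (zlift H y).
Proof. by rewrite /zlift !lnext_translate. Qed.

Lemma zlift_period n : x (n + K) = ltranslate m (x n).
Proof.
have xK : x K = ltranslate m (a, 0).
  by rewrite zlift_iter /m /strip_class sum_porbit permX iter_porbit /ltranslate add0r.
rewrite /x iterD -/(x K) xK; elim: n => //= n ->.
by rewrite zlift_translate.
Qed.

Lemma zlift_periods n j : x (n + j * K) = ltranslate (m *+ j) (x n).
Proof.
elim: j => [|j IH]; first by rewrite addn0 mulr0n /ltranslate addr0; case: (x n).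
by rewrite mulSnr addnA zlift_period IH /ltranslate /= mulrSr addrA.
Qed.

Lemma corner_strip n : corner false (x n).1 = u.
Proof.
rewrite zlift_iter /=; apply: (W_porbit (corner_zeta emb)); exact: mem_porbit.
Qed.

Lemma corner_strip_odd n : corner true (bn (x n).1) = - u.
Proof. by have [_ ->] := corner_opposite emb (x n).1; rewrite corner_strip. Qed.

Lemma posV_translate k y : posV (ltail (ltranslate k y)) = posV (ltail y) + toR R k *m L.
Proof. by case: emb => _ [eV _] _ _ _; rewrite /ltail /= eV. Qed.

Lemma posF_translate c k y :
  posF c (lface H c (ltranslate k y)) = posF c (lface H c y) + toR R k *m L.
Proof. by case: emb => _ [_ eF] _ _ _; case: y => b n; rewrite /ltranslate /= eF. Qed.

Lemma pt_even n : pt n.*2 = posV (ltail (x n)).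
Proof. by rewrite /pt odd_double doubleK. Qed.

Lemma pt_odd n : pt n.*2.+1 = posF true (lface H true (x n)).
Proof. by rewrite /pt /= odd_double uphalf_double. Qed.

(** Quad edges are indexed by corners, so the edge from the black face of [x n] to the tail of
    [x n.+1] is named by the arrow of that face leaving this tail. *)
Let next_edge n := lnext H true (lnext H true (x n)).

Lemma pt_even_next n : pt n.*2.+2 = posV (ltail (next_edge n)).
Proof.
rewrite -doubleS pt_even /next_edge -(lhead_lnext H true) (lhead_lnext H false).
by [].
Qed.

Lemma lface_next_edge n : lface H true (next_edge n) = lface H true (x n).
Proof. by rewrite /next_edge !lface_lnext. Qed.

Lemma pt_step i : 0 < det2 u (pt i.+1 - pt i).
Proof.
rewrite -(odd_double_half i); case: (odd i); rewrite ?add1n ?add0n.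
  rewrite pt_odd pt_even_next -lface_next_edge (corner_lift emb) opprD addrA subrr add0r.
  have [_ ->] := corner_opposite emb (lnext H true (x i./2)).1; rewrite opprK.
  have := corner_oriented emb (lnext H true (x i./2)).1.
  by rewrite [corner true _]corner_strip_odd /det2 !mxE /=; lra.
rewrite pt_odd pt_even (corner_lift emb) addrC addKr -(corner_strip i./2).
exact: (corner_oriented emb).
Qed.

Lemma pt_edge i t : 0 <= t <= 1 -> exists n y s,
  [/\ y = x n \/ y = next_edge n, 0 <= s <= 1,
      (1 - t) *: pt i + t *: pt i.+1 = quad_point H posV posF true y s
    & exists n', ltail y = ltail (x n')].
Proof.
move=> /andP[t0 t1]; rewrite -(odd_double_half i).
case: (odd i); rewrite ?add1n ?add0n; exists i./2.
  exists (next_edge i./2), t; split; first by right.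
  - by rewrite t0.
  - by rewrite pt_odd pt_even_next -lface_next_edge.
  exists i./2.+1; rewrite /next_edge -(lhead_lnext H true) (lhead_lnext H false).
  by [].
exists (x i./2), (1 - t); split; first by left.
- by rewrite subr_ge0 t1 lerBlDr lerDl.
- by rewrite pt_odd pt_even /quad_point addrC; congr (_ *: _ + _); ring.
by exists i./2.
Qed.

(** All arrows of the strip share the transverse vector [u], so a tail or a black face determines
    the rhombus. *)
Lemma strip_translate k n n' :
  ltail (x n) = ltail (ltranslate k (x n')) \/
  lface H true (x n) = lface H true (ltranslate k (x n')) ->
  x n = ltranslate k (x n').
Proof.
case=> E.
  apply: (quad_inj emb (c := false)); last by rewrite E.
  by rewrite !(corner_lift emb) E /= !corner_strip.
apply: (@lnext_inj _ H true); apply: (quad_inj emb (c := true)).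
  by rewrite !lface_lnext E.
have F : posF true (lface H true (lnext H true (x n))) =
    posF true (lface H true (lnext H true (ltranslate k (x n')))).
  by rewrite !lface_lnext E.
by move: F; rewrite !(corner_lift emb) /= !corner_strip_odd => /addIr.
Qed.

Lemma dot_det_inj (v w : 'rV[R]_2) : det2 u v = det2 u w -> dot u v = dot u w -> v = w.
Proof.
have un : u 0 0 ^+ 2 + u 0 1 ^+ 2 != 0.
  rewrite paddr_eq0 ?sqr_ge0 // !sqrf_eq0; apply/negP => /andP[/eqP u0 /eqP u1].
  have := corner_oriented emb a; rewrite /det2 -/u u0 u1 !mul0r subrr ltxx.
  by [].
rewrite /det2 /dot => E1 E2; apply: row2P; apply: (mulfI un).
  have -> : (u 0 0 ^+ 2 + u 0 1 ^+ 2) * v 0 0 =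
    u 0 0 * (u 0 0 * v 0 0 + u 0 1 * v 0 1) - u 0 1 * (u 0 0 * v 0 1 - u 0 1 * v 0 0) by ring.
  by rewrite E1 E2; ring.
have -> : (u 0 0 ^+ 2 + u 0 1 ^+ 2) * v 0 1 =
  u 0 1 * (u 0 0 * v 0 0 + u 0 1 * v 0 1) + u 0 0 * (u 0 0 * v 0 1 - u 0 1 * v 0 0) by ring.
by rewrite E1 E2; ring.
Qed.

(** In the coordinates [det2 u] and [dot u] the side of the strip is a graph with drift [k] times
    that of [m0]. It meets its translate, and injectivity makes the meeting point a shared vertex,
    face or edge. *)
Lemma strip_meets_translate k (m0 : 'rV[int]_2) : (0 < k)%N -> m = m0 *+ k ->
  exists n n', x n = ltranslate m0 (x n').
Proof.
move=> k0 mE; pose w := toR R m0 *m L.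
have wE : toR R m *m L = k%:R *: w.
  by rewrite mE /w scalemxAl scaler_nat; congr (_ *m _); rewrite /toR raddfMn.
have ptP i : pt (i + K.*2) = pt i + k%:R *: w.
  rewrite /pt oddD odd_double addbF halfD odd_double andbF add0n doubleK -wE.
  by rewrite zlift_period posF_translate posV_translate; case: (odd i).
have detD v v' : det2 u (v + v') = det2 u v + det2 u v' by rewrite /det2 !mxE; ring.
have detZ c v : det2 u (c *: v) = c * det2 u v by rewrite /det2 !mxE; ring.
have dotD v v' : dot u (v + v') = dot u v + dot u v' by rewrite /dot !mxE; ring.
have dotZ c v : dot u (c *: v) = c * dot u v by rewrite /dot !mxE; ring.
have [|||i||i [j [t [t' [t01 t'01 El Es]]]]] :=
  @periodic_graph_meets_translate R (fun i => det2 u (pt i)) (fun i => dot u (pt i))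
    _ K.*2 k (det2 u w) (dot u w).
- by move=> i; rewrite -subr_gt0; have := pt_step i; rewrite /det2 !mxE; lra.
- by rewrite double_gt0 lt0n card_porbit_neq0.
- by [].
- by rewrite ptP detD detZ.
- by rewrite -[K.*2]add0n ptP dotD dotZ.
have E : (1 - t) *: pt i + t *: pt i.+1 = (1 - t') *: pt j + t' *: pt j.+1 + w.
  by apply: dot_det_inj; rewrite ?(detD, detZ) ?(dotD, dotZ).
have [n [y [s [yn s01 yE [n1 n1E]]]]] := pt_edge i t01.
have [n' [y' [s' [yn' s'01 yE' [n1' n1E']]]]] := pt_edge j t'01.
have Q : quad_point H posV posF true y s =
    quad_point H posV posF true (ltranslate m0 y') s'.
  rewrite -yE E yE' /quad_point posF_translate posV_translate -/w !scalerDr.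
  by rewrite addrACA -scalerDl subrK scale1r.
have faceE z k1 q : (z = x k1 \/ z = next_edge k1) ->
    lface H true (ltranslate q z) = lface H true (ltranslate q (x k1)).
  by case=> -> //; rewrite /next_edge -!lnext_translate !lface_lnext.
have tr0 z : ltranslate 0 z = z :> larrow D by rewrite /ltranslate addr0; case: z.
have faceE0 z k1 : (z = x k1 \/ z = next_edge k1) -> lface H true z = lface H true (x k1).
  by move/(faceE _ _ 0); rewrite !tr0.
case: emb => _ _ inj _ _; have [_ []] := inj _ _ _ _ _ _ s01 s'01 Q.
- case=> _ _ F; exists n, n'; apply: strip_translate; right.
  by rewrite -(faceE0 _ _ yn) F (faceE _ _ _ yn').
- case=> _ T; exists n1, n1'; apply: strip_translate; left.
  have tlE z : ltail (ltranslate m0 z) = ((ltail z).1, (ltail z).2 + m0) by [].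
  by rewrite -n1E T !tlE n1E'.
case=> _ F; exists n, n'; apply: strip_translate; right.
by rewrite -(faceE0 _ _ yn) F (faceE _ _ _ yn').
Qed.

(** Since the strip shares an arrow with its translate by [m0], periodicity makes [m0] a multiple
    [j] of [m], so [j * k = 1]; the opposite order of indices would make a positive multiple of [m0]
    vanish. *)
Lemma strip_class_indivisible k (m0 : 'rV[int]_2) : m != 0 -> (0 < k)%N ->
  m = m0 *+ k -> k = 1%N.
Proof.
move=> mn k0 mE; have [n [n' E]] := strip_meets_translate k0 mE.
have m00 : m0 != 0 by apply: contraNneq mn => m00; rewrite mE m00 mul0rn.
have mulI i j : m0 *+ i = m0 *+ j -> i = j.
  move/rowP => h; have /eqP/rV0Pn[c mc] : m0 <> 0 by apply/eqP.
  by have := h c; rewrite !mulmxnE => /(mulrIn mc).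
have E1 : (zeta D ^+ n)%g a = (zeta D ^+ n')%g a.
  by have := congr1 fst E; rewrite /ltranslate /= !zlift_iter.
have [le|lt] := leqP n' n.
  have /eqP : (zeta D ^+ (n - n'))%g a = a.
    apply: (@perm_inj _ (zeta D ^+ n')%g); rewrite -permM -expgD subnK //.
  rewrite porbit_expE -/K => /dvdnP[j jE].
  move: E; rewrite -(subnKC le) jE zlift_periods /ltranslate => /(congr1 snd) /= /addrI.
  rewrite mE -mulrnA -{2}[m0]mulr1n => /mulI.
  by move/eqP; rewrite muln_eq1 => /andP[/eqP].
have /eqP : (zeta D ^+ (n' - n))%g a = a.
  apply: (@perm_inj _ (zeta D ^+ n)%g); rewrite -permM -expgD subnK // ltnW //.
rewrite porbit_expE -/K => /dvdnP[j jE].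
move: E; rewrite -(subnKC (ltnW lt)) jE zlift_periods /ltranslate /= => /(congr1 snd) /=.
rewrite -addrA -[LHS]addr0 => /addrI; rewrite mE -mulrnA -{2}[m0]mulr1n -mulrnDr.
by rewrite -[0](mulr0n m0) => /mulI; rewrite addn1.
Qed.

Lemma strip_class_primitive : m != 0 -> primitive m.
Proof.
move=> mn; pose g := gcdz (m 0 0) (m 0 1).
have gE : g = `|g|%N by rewrite gez0_abs // /g /gcdz.
have g0 : (0 < `|g|)%N.
  rewrite absz_gt0 gcdz_eq0; apply: contraNN mn => /andP[/eqP h0 /eqP h1].
  by apply/eqP/row2P; rewrite mxE.
pose m0 := \row_j divz (m 0 j) g : 'rV[int]_2.
have E : m = m0 *+ `|g|%N.
  apply: row2P; rewrite mulmxnE mxE -mulr_natr natz -gE divzK //.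
    exact: dvdz_gcdl.
  exact: dvdz_gcdr.
rewrite /primitive /coprimez -/g gE.
by rewrite (strip_class_indivisible mn g0 E).
Qed.

End Primitivity.

(** * The matching of a two dimensional cone *)

Section Cones.
Variables (R : realType) (e : R).
Local Notation form := (form e).
Implicit Types p q r : 'rV[R]_2.

Lemma form_exchange p q r s :
  form p r * form s q = form p s * form r q + form p q * form s r.
Proof. by rewrite /form /det2; ring. Qed.

Lemma form_decomposition p q r : form p q != 0 ->
  r = (form r q / form p q) *: p + (form p r / form p q) *: q.
Proof.
rewrite /form mulf_eq0 negb_or => /andP[e0 d0]; have := d0; rewrite /det2 => d0'.
by apply: row2P; rewrite !mxE /det2; field; rewrite d0' e0.
Qed.

Lemma form_open_cone p q r :
  0 < form p q -> 0 < form p r -> 0 < form r q -> open_cone2 p q r.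
Proof.
move=> pq pr rq; exists (form r q / form p q), (form p r / form p q).
by split; rewrite ?divr_gt0 //; apply: form_decomposition; rewrite gt_eqF.
Qed.

Lemma form_cone p q r : 0 < form p q -> 0 <= form p r -> 0 <= form r q -> cone2 p q r.
Proof.
move=> pq pr rq; exists (form r q / form p q), (form p r / form p q).
by split; rewrite ?divr_ge0 // ?(ltW pq) //; apply: form_decomposition; rewrite gt_eqF.
Qed.

Lemma open_cone_form p q r : 0 < form p q -> open_cone2 p q r ->
  0 < form p r /\ 0 < form r q.
Proof.
move=> pq [s [t [s0 t0 ->]]].
rewrite formDr formDl !formZr !formZl !formvv !mulr0 add0r addr0.
by split; rewrite mulr_gt0.
Qed.

Lemma cone2C p q : cone2 p q = cone2 q p.
Proof.
by apply/seteqP; split=> r [s [t [s0 t0 ->]]]; exists t, s; split=> //; rewrite addrC.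
Qed.

Lemma open_cone2C p q : open_cone2 p q = open_cone2 q p.
Proof.
by apply/seteqP; split=> r [s [t [s0 t0 ->]]]; exists t, s; split=> //; rewrite addrC.
Qed.

Lemma ray_self p : ray p p.
Proof. by exists 1; rewrite ?scale1r. Qed.

End Cones.

Section ConeMatching.
Variables (R : realType) (D : dimer_model) (H : homology_marking D).
Variables (L : 'M[R]_2) (posV : lvertex D -> 'rV[R]_2).
Variable posF : bool -> set (larrow D) -> 'rV[R]_2.
Hypothesis emb : rhombic_embedding H posV posF L.
Local Notation bn := (bnext D).
Local Notation wn := (wnext D).
Local Notation Z := (strip_vector R H).
Local Notation Y := (Zback Z).
Variable e : R.
Local Notation form := (form e).
Local Notation B := (selected e Z).
Hypothesis Zpos : forall a, 0 < form (Y a) (Z a).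
Hypothesis strip_form : forall a w, is_cycle w ->
  (\sum_b strip a b * w b)%:~R = form (toR R (chain_class H w)) (Z a).

Let Zw := strip_vector_zeta R H.

Lemma strip_class_neq0 a : strip_class H a != 0.
Proof.
apply/eqP => z0; have := Zpos a; rewrite /form /strip_vector z0 /det2 !mxE.
by rewrite mulr0 mulr0 subrr mulr0 ltxx.
Qed.

Lemma flow_through a (s : bool) : exists eta (n : int),
  [/\ zigzag_flow H eta, eta n = (a, 0)
    & flow_class H eta (strip_class H (if s then a else (bn^-1)%g a))].
Proof.
case: s.
  exists (zigzag_of H (a, 0)), 0; split; rewrite ?zigzag_of0 //.
    exact: zigzag_of_flow.
  have := flow_class_strip emb (zigzag_of_flow H (a, 0)).
  by rewrite zigzag_of0.
pose x : larrow D := lprev H true (a, 0).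
exists (zigzag_of H x), 1; split; rewrite ?zigzag_of1 ?lprevK //.
  exact: zigzag_of_flow.
have := flow_class_strip emb (zigzag_of_flow H x).
by rewrite zigzag_of0.
Qed.

Lemma strip_class_global a : global_classes H (strip_class H a).
Proof. by have [eta [n [zf _ fc]]] := flow_through a true; exists eta. Qed.

Lemma strip_class_local f a (s : bool) : a \in boundary f ->
  local_classes H f (strip_class H (if s then a else (bn^-1)%g a)).
Proof.
move=> af; have [eta [n [zf etan fc]]] := flow_through a s.
by exists eta; split=> //; exists n; rewrite etan.
Qed.

Lemma global_class_strip m : global_classes H m -> exists a, m = strip_class H a.
Proof. by case=> eta zf fc; exists (eta 0).1; apply: (flow_class_unique emb zf fc). Qed.

(** If the flow uses the arrow as an odd one, its even neighbour on the same face represents it: the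
    predecessor on a black face, the successor on a white one. *)
Lemma local_class_strip f m : local_classes H f m ->
  exists2 b, b \in boundary f & m = strip_class H b.
Proof.
case=> eta [zf fc [n nf]]; have [->|->] := flow_class_at emb zf n fc.
  by exists (eta n).1.
set a := (eta n).1 in nf *; have fE := face_of_boundary nf.
move: fE nf; case: (val f).1 => -> af.
  exists ((bn^-1)%g a) => //; rewrite boundary_face /= -(porbit_stable bn) permKV.
  exact: porbit_id.
exists (wn a); first by rewrite boundary_face porbit_stable porbit_id.
by rewrite -{2}[a](permKV bn) strip_class_zeta.
Qed.

(* A class of f inside the cone of a could be pushed slightly to a generic    *)
(* direction selecting two arrows of f.                                       *)
Lemma corner_cone_empty f a b : a \in boundary f -> b \in boundary f ->
  0 < form (Y a) (Z b) -> 0 < form (Z b) (Z a) -> False.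
Proof.
move=> af bf Yb bZ.
have [T HT] := generic_combination Zpos (lt0r_neq0 (Zpos b)).
pose t := Num.max T 0 + 1.
have mT : T < t by rewrite (@le_lt_trans _ _ (Num.max T 0)) ?le_max ?lexx ?ltrDl.
have t0 : 0 < t.
  by rewrite (@le_lt_trans _ _ (Num.max T 0)) ?le_max ?lexx ?orbT ?ltrDl.
have [gv sv] := HT _ mT; set v := Y b + t *: Z b in gv sv.
have vZ : 0 < form v (Z a) by have := sv a (lt0r_neq0 bZ); rewrite pmulr_rgt0.
have Yv : 0 < form (Y a) v.
  have Yb' : form (Z b) (Y a) < 0 by rewrite form_anti oppr_lt0.
  have := sv _ (ltr0_neq0 Yb'); rewrite nmulr_rgt0 // => h.
  by rewrite form_anti oppr_gt0.
have Ba : B v a by rewrite selectedE // Yv vZ.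
have Bb : B v b.
  rewrite selectedE // /v formDr formDl formZr formZl !formvv mulr0 addr0 add0r.
  by rewrite Zpos mulr_gt0.
by move: bZ; rewrite (selected_inj Zw Zpos gv af bf Ba Bb) formvv ltxx.
Qed.

Lemma cone_det a : 0 < det2 (Y a) (Z a) \/ 0 < det2 (Z a) (Y a).
Proof.
have : det2 (Y a) (Z a) != 0.
  by have := lt0r_neq0 (Zpos a); rewrite /form mulf_eq0 negb_or => /andP[].
rewrite neq_lt => /orP[h|h]; [right|by left].
by move: h; rewrite /det2; lra.
Qed.

Lemma corner_cone_fan f a : a \in boundary f -> local_fan H f (cone2 (Y a) (Z a)).
Proof.
move=> af; have none m : local_classes H f m -> ~ open_cone2 (Y a) (Z a) (toR R m).
  move=> /local_class_strip[b bf ->] /(open_cone_form (Zpos a))[h1 h2].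
  exact: (corner_cone_empty af bf h1 h2).
have [lz ly] := (strip_class_local true af, strip_class_local false af).
apply: Or33; have [h|h] := cone_det a.
  by exists (strip_class H ((bn^-1)%g a)), (strip_class H a).
exists (strip_class H a), (strip_class H ((bn^-1)%g a)); split=> //.
  by rewrite cone2C.
by rewrite open_cone2C.
Qed.

Lemma corner_cone_arrow f a : a \in boundary f ->
  corresponding_arrow H f (cone2 (Y a) (Z a)) a.
Proof.
move=> af; split=> //.
have [ez [nz [zz ezn cz]]] := flow_through a true.
have [ey [ny [zy eyn cy]]] := flow_through a false.
have prim b : primitive (strip_class H b).
  by apply: (strip_class_primitive emb); apply: strip_class_neq0.
have rz : represents H ez (ray (Z a)) by exists (strip_class H a).
have ry : represents H ey (ray (Y a)) by exists (strip_class H ((bn^-1)%g a)).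
have [h|h] := cone_det a.
  exists (ray (Y a)), (ray (Z a)), ey, ez; split=> //.
    by exists (Y a), (Z a).
  by exists ny, nz; rewrite eyn ezn.
exists (ray (Z a)), (ray (Y a)), ez, ey; split=> //.
  by exists (Z a), (Y a); split=> //; rewrite cone2C.
by exists nz, ny; rewrite eyn ezn.
Qed.

Lemma ray_eq (u w : 'rV[R]_2) : ray u = ray w -> exists2 c, 0 <= c & u = c *: w.
Proof. by move=> E; have := ray_self u; rewrite E. Qed.

(** Both flows pass through [a], so their classes are [Y a] or [Z a]. Equal classes would put [v] on
    one of these rays, against genericity. *)
Lemma corresponding_arrow_selected f tau a v : generic e Z v -> tau v ->
  corresponding_arrow H f tau a -> B v a.
Proof.
move=> gv tv [af [g1 [g2 [eta1 [eta2 [[u1 [u2 [d12 tauE g1E g2E]]]]]]]]].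
move=> [z1 [m1 [fc1 _ r1]]] [z2 [m2 [fc2 _ r2]]] [n1 [n2 [E12 E1a]]].
have E2a : (eta2 n2).1 = a by rewrite -E12.
move: tv; rewrite tauE => -[s [t [s0 t0 vE]]].
have [c1 c10 u1E] : exists2 c, 0 <= c & u1 = c *: toR R m1.
  by apply: ray_eq; rewrite -g1E.
have [c2 c20 u2E] : exists2 c, 0 <= c & u2 = c *: toR R m2.
  by apply: ray_eq; rewrite -g2E.
have classes m : m = strip_class H a \/ m = strip_class H ((bn^-1)%g a) ->
    toR R m = Z a \/ toR R m = Y a by case=> ->; [left|right].
have [sc tc] : 0 <= s * c1 /\ 0 <= t * c2 by rewrite !mulr_ge0.
move: vE; rewrite u1E u2E !scalerA.
have main p q : 0 <= p -> 0 <= q -> v = p *: Y a + q *: Z a -> B v a.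
  move=> p0 q0 vE; rewrite selectedE // !lt_neqAle.
  have -> : 0 != form (Y a) v by rewrite form_anti eq_sym oppr_eq0; apply: gv.
  have -> : 0 != form v (Z a) by rewrite eq_sym; apply: gv.
  rewrite vE formDr formDl !formZr !formZl !formvv !mulr0 add0r addr0.
  have yz := ltW (Zpos a).
  by apply/andP; split; exact: mulr_ge0.
have := flow_class_at emb z1 n1 fc1; rewrite E1a => /classes[->|->];
  have := flow_class_at emb z2 n2 fc2; rewrite E2a => /classes[->|->] vE.
- by case/eqP: (gv a); rewrite vE -scalerDl formZl formvv mulr0.
- by apply: (main _ _ tc sc); rewrite vE addrC.
- exact: main sc tc vE.
- by case/eqP: (gv ((bn^-1)%g a)); rewrite vE -scalerDl formZl formvv mulr0.
Qed.

Variables (b1 b2 : arrow D).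
Hypothesis b12 : 0 < form (Z b1) (Z b2).
Hypothesis empty : forall a, ~ open_cone2 (Z b1) (Z b2) (Z a).
Variable v : 'rV[R]_2.
Hypothesis v_gen : generic e Z v.
Hypothesis v1 : 0 < form (Z b1) v.
Hypothesis v2 : 0 < form v (Z b2).

Lemma sector_not_inside a : 0 < form (Z b1) (Z a) -> 0 < form (Z a) (Z b2) -> False.
Proof. by move=> h1 h2; apply: (@empty a); exact: (form_open_cone b12). Qed.

Lemma v_in_sector : cone2 (Z b1) (Z b2) v.
Proof. by apply: (form_cone b12); apply: ltW. Qed.

(** Both sectors contain [v], and neither [Y a] nor [Z a] can lie strictly inside the empty sector
    of [b1] and [b2], so they bound it from outside. *)
Lemma sector_sub_corner_cone a : B v a -> (cone2 (Z b1) (Z b2) `<=` cone2 (Y a) (Z a))%classic.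
Proof.
rewrite selectedE // => /andP[Yv vZ].
have Y1 : 0 <= form (Y a) (Z b1).
  rewrite leNgt; apply/negP => h; have h' : 0 < form (Z b1) (Y a).
    by rewrite form_anti oppr_gt0.
  apply: (@sector_not_inside ((bn^-1)%g a)) => //.
  rewrite -(pmulr_rgt0 _ v1) form_exchange.
  by apply: addr_gt0; apply: mulr_gt0.
have Z1 : 0 < form (Z b1) (Z a).
  rewrite -(pmulr_rgt0 _ Yv) form_exchange; apply: ltr_wpDl.
    by apply: mulr_ge0 => //; apply: ltW.
  exact: mulr_gt0 (Zpos a) v1.
have Z2 : 0 <= form (Z b2) (Z a).
  rewrite leNgt; apply/negP => h; apply: (@sector_not_inside a) => //.
  by rewrite form_anti oppr_gt0.
have Y2 : 0 < form (Y a) (Z b2).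
  rewrite -(pmulr_lgt0 _ vZ).
  have -> : form (Y a) (Z b2) * form v (Z a) =
    form (Y a) v * form (Z b2) (Z a) + form (Y a) (Z a) * form v (Z b2).
    exact: form_exchange.
  apply: ltr_wpDl; first by apply: mulr_ge0 => //; apply: ltW.
  exact: mulr_gt0 (Zpos a) v2.
move=> r [s [t [s0 t0 ->]]]; apply: form_cone => //.
  by rewrite formDr !formZr; apply: addr_ge0; apply: mulr_ge0 => //; apply: ltW.
by rewrite formDl !formZl; apply: addr_ge0; apply: mulr_ge0 => //; apply: ltW.
Qed.

Lemma P_faceE f a : P_face H (cone2 (Z b1) (Z b2)) f a =
  (((a \in boundary f) && B v a) : nat)%:Z.
Proof.
rewrite ffunE; congr (Posz (nat_of_bool _)); apply/asboolP/andP.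
  case=> tau [_ _ sub ca]; split; first by case: ca.
  by apply: (corresponding_arrow_selected v_gen _ ca); apply: sub; apply: v_in_sector.
case=> af Ba; exists (cone2 (Y a) (Z a)); split.
- exact: corner_cone_fan.
- exists (Y a), (Z a); split.
  + by apply: (form_cone (Zpos a)); rewrite ?formvv // ltW.
  + by apply: (form_cone (Zpos a)); rewrite ?formvv // ltW.
  by have := lt0r_neq0 (Zpos a); rewrite /form mulf_eq0 negb_or => /andP[].
- exact: sector_sub_corner_cone.
exact: corner_cone_arrow.
Qed.

Lemma P_coneE a : (matching e Z v a)%:~R = P_cone H (cone2 (Z b1) (Z b2)) a.
Proof.
rewrite /P_cone ffunE.
have -> : \sum_(f : Q2 D) (P_face H (cone2 (Z b1) (Z b2)) f a)%:~R =
    \sum_(f : Q2 D | a \in boundary f) ((B v a : nat)%:Z)%:~R :> rat.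
  rewrite [RHS]big_mkcond; apply: eq_bigr => f _; rewrite P_faceE.
  by case: (a \in boundary f).
rewrite (sum_faces_at (fun=> ((B v a : nat)%:Z)%:~R : rat)).
by case: (B v a).
Qed.

Lemma strip_vector_orbit a b : b \in porbit (zeta D) a -> Z b = Z a.
Proof. by rewrite -eq_porbit_mem /strip_vector /strip_class => /eqP ->. Qed.

(** The sector of [bn b] starts at [Z b1]; if it ended before [v], its end would lie inside the
    empty sector. Dually, along [b2] the even arrow itself is selected. *)
Lemma sector_start_selected b : b \in porbit (zeta D) b1 -> B v b || B v (bn b).
Proof.
move=> /strip_vector_orbit Zb; apply/orP; right.
have Yb : Y (bn b) = Z b1 by rewrite Zback_bn.
rewrite selectedE // Yb v1 /= ltNge; apply/negP => le.
have lt : 0 < form (Z (bn b)) v.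
  rewrite form_anti oppr_gt0 lt_neqAle le andbT; exact: v_gen.
have h1 : 0 < form (Z b1) (Z (bn b)) by rewrite -Yb.
apply: (sector_not_inside h1).
by rewrite -(pmulr_rgt0 _ v1) form_exchange; apply: addr_gt0; apply: mulr_gt0.
Qed.

Lemma sector_end_selected b : b \in porbit (zeta D) b2 -> B v b || B v (bn b).
Proof.
move=> /strip_vector_orbit Zb; apply/orP; left.
rewrite selectedE // Zb v2 andbT ltNge; apply/negP => le.
have lt : 0 < form v (Y b).
  rewrite form_anti oppr_gt0 lt_neqAle le andbT form_anti oppr_eq0; exact: v_gen.
have h2 : 0 < form (Y b) (Z b2) by rewrite -Zb.
have h1 : 0 < form (Z b1) (Y b).
  rewrite -(pmulr_lgt0 _ v2).
  have -> : form (Z b1) (Y b) * form v (Z b2) =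
    form (Z b1) v * form (Y b) (Z b2) + form (Z b1) (Z b2) * form v (Y b).
    by rewrite /form /det2; ring.
  by apply: addr_gt0; apply: mulr_gt0.
exact: (@sector_not_inside ((bn^-1)%g b)).
Qed.

Lemma sector_matching : exists pi : {ffun arrow D -> int},
  [/\ forall a, (pi a)%:~R = P_cone H (cone2 (Z b1) (Z b2)) a,
      perfect_matching pi,
      extremal R pi
    & has_multiplicity (No_class pi) 1].
Proof.
exists (matching e Z v).
have pm := matching_perfect Zw Zpos v_gen.
have [w [wc w0 wE]] := supporting_cycle Zpos strip_form v_gen
  (lt0r_neq0 b12) sector_start_selected sector_end_selected.
have wE' a : (w a == 0) = (matching e Z v a != 0).
  by rewrite wE ffunE; case: (B v a).
split=> //; first exact: P_coneE.
  exact: (supported_extremal pm wc w0 wE').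
exact: (supported_multiplicity_one pm wc w0 wE').
Qed.

End ConeMatching.

Theorem corollary4p27 (R : realType) (D : dimer_model) (H : homology_marking D)
    (consistent : geometrically_consistent R H)
    (sigma : set 'rV[R]_2) (sigma_fan : global_fan H sigma)
    (sigma_dim2 : two_dimensional sigma) :
  exists pi : {ffun arrow D -> int},
    [/\ forall a, (pi a)%:~R = P_cone H sigma a,
        perfect_matching pi,
        extremal R pi
      & has_multiplicity (No_class pi) 1].
Proof.
have [L [posV [posF emb]]] := consistent.
have [e [Zpos strip_form]] :=
  intersection_form H (corner_zeta emb) (corner_pos emb).
have sector (b1 b2 : arrow D) :
    0 < form e (strip_vector R H b1) (strip_vector R H b2) ->
    (forall m, global_classes H m ->
      ~ open_cone2 (strip_vector R H b1) (strip_vector R H b2) (toR R m)) ->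
    exists pi : {ffun arrow D -> int},
      [/\ forall a, (pi a)%:~R =
            P_cone H (cone2 (strip_vector R H b1) (strip_vector R H b2)) a,
          perfect_matching pi, extremal R pi & has_multiplicity (No_class pi) 1].
  move=> b12 empty.
  (* Any positive multiple of the second class added to the first lies inside the sector; a large
     one makes the direction generic. *)
  have [T HT] := generic_combination Zpos (lt0r_neq0 b12).
  have mT : T < Num.max T 0 + 1.
    by rewrite (@le_lt_trans _ _ (Num.max T 0)) ?le_max ?lexx ?ltrDl.
  have t0 : 0 < Num.max T 0 + 1.
    by rewrite (@le_lt_trans _ _ (Num.max T 0)) ?le_max ?lexx ?orbT ?ltrDl.
  have [gv _] := HT _ mT.
  apply: (sector_matching emb Zpos strip_form b12 _ gv) => [a||].
  - by apply: empty; apply: strip_class_global emb _.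
  - by rewrite formDr formZr formvv add0r mulr_gt0.
  by rewrite formDl formZl formvv mulr0 addr0.
case: sigma_fan => [E|[m _ E]|[m1 [m2 [g1 g2 d12 -> empty]]]].
- case: sigma_dim2 => u [w []]; rewrite E /= => -> ->.
  by rewrite /det2 !mxE mul0r subrr eqxx.
- case: sigma_dim2 => u [w []]; rewrite E => -[s _ ->] [t _ ->].
  by rewrite /det2 !mxE => /eqP; case; ring.
have [b1 m1E] := global_class_strip emb g1.
have [b2 m2E] := global_class_strip emb g2.
rewrite {}m1E {}m2E in d12 empty *.
have e0 := form_const_neq0 Zpos b1.
(* The fan orders the two rays by [det2]; if [e] is negative, the order for [form] is the opposite
   one. *)
move: e0; rewrite neq_lt => /orP[e0|e0].
  rewrite cone2C; apply: sector => [|m gm].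
    by rewrite form_anti /form -mulNr mulr_gt0 // oppr_gt0.
  by rewrite open_cone2C; apply: empty.
by apply: sector => //; rewrite /form mulr_gt0.
Qed.
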